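(* Let $M$ be a simple $\mathcal{A}_1$-module. Then $M$ is isomorphic to one and only one of the following modules: $S_\epsilon$; $S_{\operatorname{sgn}}$; $S_{\operatorname{st}}(\mathrm{i})$, $S_{\operatorname{st}}(-\mathrm{i})$, $S_{\operatorname{st}}(\frac{\mathrm{i}}{3})$, $S_{\operatorname{st}}(-\frac{\mathrm{i}}{3})$.
   Context: $\Bbbk$ is an algebraically closed field of characteristic zero, $\mathrm{i}=\sqrt{-1}\in\Bbbk$. $\mathcal{A}_1$ is the 72-dimensional Hopf algebra generated as an algebra by $H_t$ ($t\in\mathbb{S}_3$) and $a_{12},a_{13},a_{23}$ (indexed by the transpositions of $\mathbb{S}_3$; $H_{12}=H_{(12)}$, etc.), with relations $H_e=1$, $H_tH_s=H_{ts}$; $H_ta_i=\operatorname{sgn}(t)a_{tit^{-1}}H_t$; $a_{12}^2=0$; $a_{12}a_{23}+a_{23}a_{13}+a_{13}a_{12}=1-H_{12}H_{23}$. Since $a_{13}=-H_{23}a_{12}H_{23}$ and $a_{23}=-H_{13}a_{12}H_{13}$, an $\mathcal{A}_1$-module is determined by the $\mathbb{S}_3$-action (via $t\mapsto H_t$) and the action of $a_{12}$. $S_\epsilon$, $S_{\operatorname{sgn}}$ are the one-dimensional modules where $H_t$ acts by the trivial, resp. sign, character and all $a_i$ act by $0$. The standard representation $W_{\operatorname{st}}$ of $\mathbb{S}_3$ has canonical basis $\{v,w\}$ with $H_{12}v=w$, $H_{12}w=v$; $H_{23}v=v-w$, $H_{23}w=-w$; $H_{13}v=-v$, $H_{13}w=-v+w$.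 The modules $S_{\operatorname{st}}(\theta)$ are supported on $W_{\operatorname{st}}$ with: $a_{12}v=a_{12}w=\theta(v-w)$ for $\theta=\pm\mathrm{i}$; and $a_{12}v=\theta(v+w)$, $a_{12}w=-\theta(v+w)$ for $\theta=\pm\frac{\mathrm{i}}{3}$. *)

(* Defs.v *)
From HB Require Import structures.
From mathcomp Require Import all_boot all_order all_algebra all_fingroup.
From mathcomp Require Import generic_quotient ring_quotient boolp.
From mathcomp.multinomials Require Import monalg.
From mathcomp Require Import ring.

Set Implicit Arguments.
Unset Strict Implicit.
Unset Printing Implicit Defensive.

Import GRing.Theory.

Local Open Scope ring_scope.
Local Open Scope quotient_scope.

Definition freealg (k : fieldType) (G : choiceType) : Type :=
  {malg k[{fmonom G}]}.

Section FreeAlgebra.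
Variables (k : fieldType) (G : choiceType).

HB.instance Definition _ := GRing.Lalgebra.on (freealg k G).

Definition fgen (g : G) : freealg k G := << fmu g >>%R.

Lemma freealg_scaleAr (c : k) (x y : freealg k G) :
  c *: (x * y) = x * (c *: y).
Proof.
suff cC : x * c%:MP = c *: x.
  by rewrite scalerAl -cC -mulrA mul_malgC.
rewrite malgM_def fgmulgU malgZ_def; apply: eq_bigr => m _.
by rewrite mulm1 mulrC.
Qed.

HB.instance Definition _ :=
  GRing.Lalgebra_isAlgebra.Build k (freealg k G) freealg_scaleAr.

Variables (n : nat) (f : G -> 'M[k]_n.+1).

Definition fmon_eval (m : {fmonom G}) : 'M[k]_n.+1 := \prod_(g <- m : seq G) f g.

Lemma fmon_eval_morph : mmorphism fmon_eval.
Proof.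
split=> [x y|]; rewrite /fmon_eval ?fmM ?fm1 ?big_nil //.
by rewrite big_cat.
Qed.

HB.instance Definition _ := isMultiplicative.Build _ _ fmon_eval fmon_eval_morph.

Definition feval : freealg k G -> 'M[k]_n.+1 := mmap (@scalar_mx k n.+1) fmon_eval.

Lemma feval_is_zmod_morphism : zmod_morphism feval.
Proof. exact: (@mmap_is_additive _ _ _ (@scalar_mx k n.+1) fmon_eval). Qed.

Lemma feval_is_monoid_morphism : monoid_morphism feval.
Proof.
have [fM f1] : multiplicative feval.
  apply: (@commr_mmap_is_multiplicative _ _ _ (@scalar_mx k n.+1) fmon_eval).
  by move=> x m m'; rewrite /GRing.comm -!mulmxE scalar_mxC.
by split.
Qed.

HB.instance Definition _ :=
  GRing.isZmodMorphism.Build _ _ feval feval_is_zmod_morphism.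
HB.instance Definition _ :=
  GRing.isMonoidMorphism.Build _ _ feval feval_is_monoid_morphism.

Lemma feval_gen g : feval (fgen g) = f g.
Proof.
by rewrite /feval /fgen mmapU /= mul1r /fmon_eval fmU big_seq1.
Qed.

Lemma fevalZ c x : feval (c *: x) = c *: feval x.
Proof. by rewrite /feval mmapZ /= -mul_scalar_mx. Qed.

HB.instance Definition _ :=
  GRing.isScalable.Build k (freealg k G) 'M[k]_n.+1 *:%R feval fevalZ.

End FreeAlgebra.

Section QuotientAlgebra.
Variables (k : fieldType) (R : algType k) (P : R -> Prop).

Definition two_sided_ideal (J : R -> Prop) : Prop :=
  [/\ J 0, forall x y, J x -> J y -> J (x - y)
    & forall a b x, J x -> J (a * x * b)].

(* Membership in the two-sided ideal generated by P.  MathComp's ring quotients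
   need a boolean predicate and its {ideal_quot _} is for commutative rings,
   whence the classical reflection and the ring structure built below. *)
Definition gen_ideal : {pred R} := fun x =>
  `[< forall J, two_sided_ideal J -> (forall r, P r -> J r) -> J x >].

Lemma gen_idealP x :
  reflect (forall J, two_sided_ideal J -> (forall r, P r -> J r) -> J x)
          (x \in gen_ideal).
Proof. exact: asboolP. Qed.

Lemma gen_ideal_incl r : P r -> r \in gen_ideal.
Proof. by move=> Pr; apply/gen_idealP => J _; apply. Qed.

Lemma gen_ideal_zmod_closed : zmod_closed gen_ideal.
Proof.
split=> [|x y /gen_idealP Ix /gen_idealP Iy]; apply/gen_idealP => J JI JP.
  by case: JI.
by case: (JI) => _ JB _; apply: JB; [apply: Ix | apply: Iy].
Qed.

HB.instance Definition _ := GRing.isZmodClosed.Build R gen_ideal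
  gen_ideal_zmod_closed.

Lemma gen_idealM a b x : x \in gen_ideal -> a * x * b \in gen_ideal.
Proof.
move=> /gen_idealP Ix; apply/gen_idealP => J JI JP.
by case: (JI) => _ _ JM; apply: JM; apply: Ix.
Qed.

Lemma gen_idealMl a x : x \in gen_ideal -> a * x \in gen_ideal.
Proof. by move/(gen_idealM a 1); rewrite mulr1. Qed.

Lemma gen_idealMr b x : x \in gen_ideal -> x * b \in gen_ideal.
Proof. by move/(gen_idealM 1 b); rewrite mul1r. Qed.

Lemma gen_idealZ c x : x \in gen_ideal -> c *: x \in gen_ideal.
Proof. by rewrite -mulr_algl; apply: gen_idealMl. Qed.

Definition quotalg : Type := Quotient.quot gen_ideal.

HB.instance Definition _ := GRing.Zmodule.on quotalg.

Definition qpi (x : R) : quotalg := \pi_(Quotient.quot gen_ideal) x.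
Definition qrepr (p : quotalg) : R := repr (p : Quotient.quot gen_ideal).

Lemma qreprK : cancel qrepr qpi.
Proof. exact: reprK. Qed.

Lemma qpiP x y : (qpi x = qpi y) <-> (x - y \in gen_ideal).
Proof. by rewrite (Quotient.idealrBE gen_ideal); split=> [/eqP|/eqP]. Qed.

Lemma qpi_is_zmod_morphism : zmod_morphism qpi.
Proof. exact: (@pi_is_zmod_morphism _ _ _ (Quotient.quot gen_ideal)). Qed.

HB.instance Definition _ := GRing.isZmodMorphism.Build R quotalg qpi
  qpi_is_zmod_morphism.

Lemma qreprB x : qrepr (qpi x) - x \in gen_ideal.
Proof. by apply/qpiP; rewrite qreprK. Qed.

Definition qone : quotalg := qpi 1.
Definition qmul (p q : quotalg) : quotalg := qpi (qrepr p * qrepr q).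
Definition qscale (c : k) (p : quotalg) : quotalg := qpi (c *: qrepr p).

Lemma qmulE x y : qmul (qpi x) (qpi y) = qpi (x * y).
Proof.
apply/qpiP; rewrite -(subrK (x * qrepr (qpi y)) (_ * _)) -mulrBl -addrA -mulrBr.
by apply: rpredD; [apply: gen_idealMr | apply: gen_idealMl]; apply: qreprB.
Qed.

Lemma qscaleE c x : qscale c (qpi x) = qpi (c *: x).
Proof. by apply/qpiP; rewrite -scalerBr; apply/gen_idealZ/qreprB. Qed.

Lemma qmulA : associative qmul.
Proof.
by move=> p q r; rewrite -[p]qreprK -[q]qreprK -[r]qreprK !qmulE mulrA.
Qed.

Lemma qmul1 : left_id qone qmul.
Proof. by move=> p; rewrite -[p]qreprK qmulE mul1r. Qed.

Lemma qmulr1 : right_id qone qmul.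
Proof. by move=> p; rewrite -[p]qreprK qmulE mulr1. Qed.

Lemma qmulDl : left_distributive qmul +%R.
Proof.
move=> p q r; rewrite -[p]qreprK -[q]qreprK -[r]qreprK.
by rewrite -raddfD !qmulE mulrDl raddfD.
Qed.

Lemma qmulDr : right_distributive qmul +%R.
Proof.
move=> p q r; rewrite -[p]qreprK -[q]qreprK -[r]qreprK.
by rewrite -raddfD !qmulE mulrDr raddfD.
Qed.

HB.instance Definition _ :=
  GRing.Zmodule_isPzRing.Build quotalg qmulA qmul1 qmulr1 qmulDl qmulDr.

Lemma qscalerA a b p : qscale a (qscale b p) = qscale (a * b) p.
Proof. by rewrite -[p]qreprK !qscaleE scalerA. Qed.

Lemma qscale1 : left_id 1 qscale.
Proof. by move=> p; rewrite -[p]qreprK qscaleE scale1r. Qed.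

Lemma qscaleDr : right_distributive qscale +%R.
Proof.
by move=> c p q; rewrite -[p]qreprK -[q]qreprK -raddfD !qscaleE scalerDr raddfD.
Qed.

Lemma qscaleDl p : {morph qscale^~ p : a b / a + b}.
Proof. by move=> a b /=; rewrite -[p]qreprK !qscaleE scalerDl raddfD. Qed.

HB.instance Definition _ := GRing.Zmodule_isLmodule.Build k quotalg
  qscalerA qscale1 qscaleDr qscaleDl.

Lemma qpi_is_monoid_morphism : monoid_morphism qpi.
Proof. by split=> // x y; rewrite -qmulE. Qed.

HB.instance Definition _ := GRing.isMonoidMorphism.Build R quotalg qpi
  qpi_is_monoid_morphism.

Lemma qpiZ c x : qpi (c *: x) = c *: qpi x.
Proof. by rewrite -qscaleE. Qed.

Lemma quotalg_scalerAl (c : k) (p q : quotalg) : c *: (p * q) = (c *: p) * q.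
Proof.
by rewrite -[p]qreprK -[q]qreprK -rmorphM -!qpiZ -rmorphM scalerAl.
Qed.

Lemma quotalg_scalerAr (c : k) (p q : quotalg) : c *: (p * q) = p * (c *: q).
Proof.
by rewrite -[p]qreprK -[q]qreprK -rmorphM -!qpiZ -rmorphM scalerAr.
Qed.

HB.instance Definition _ := GRing.isScalable.Build k R quotalg *:%R qpi qpiZ.

Section Lift.
Variables (S : algType k) (phi : {lrmorphism R -> S}).
Hypothesis phiP : forall r, P r -> phi r = 0.

Lemma gen_ideal_ker x : x \in gen_ideal -> phi x = 0.
Proof.
move=> /gen_idealP /(_ (fun y => phi y = 0)); apply=> [|r /phiP//].
split=> /= [|x0 y Hx Hy|a b x0 Hx]; first by rewrite raddf0.
  by rewrite raddfB /= Hx Hy subrr.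
by rewrite !rmorphM /= Hx mulr0 mul0r.
Qed.

Definition qlift (p : quotalg) : S := phi (qrepr p).

Lemma qlift_qpi x : qlift (qpi x) = phi x.
Proof.
by apply/eqP; rewrite -subr_eq0 -raddfB /= gen_ideal_ker //; apply: qreprB.
Qed.

Lemma qliftB : zmod_morphism qlift.
Proof.
by move=> p q; rewrite -[p]qreprK -[q]qreprK -raddfB !qlift_qpi raddfB.
Qed.

Lemma qliftM : monoid_morphism qlift.
Proof.
split=> [|p q]; first by rewrite qlift_qpi rmorph1.
by rewrite -[p]qreprK -[q]qreprK -rmorphM !qlift_qpi rmorphM.
Qed.

Lemma qliftZ (c : k) (p : quotalg) : qlift (c *: p) = c *: qlift p.
Proof. by rewrite -[p]qreprK -qpiZ !qlift_qpi linearZ. Qed.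

End Lift.

End QuotientAlgebra.

Section A1.
Variable k : fieldType.

Definition is_transposition (t : {perm 'I_3}) : bool :=
  [exists x, exists y, (x != y) && (t == tperm x y)].

Definition transposition : finType := {t : {perm 'I_3} | is_transposition t}.

Lemma is_transposition_tperm (x y : 'I_3) :
  x != y -> is_transposition (tperm x y).
Proof. by move=> xy; apply/existsP; exists x; apply/existsP; exists y; rewrite xy /=. Qed.

Definition p1 : 'I_3 := Ordinal (isT : 0 < 3)%N.
Definition p2 : 'I_3 := Ordinal (isT : 1 < 3)%N.
Definition p3 : 'I_3 := Ordinal (isT : 2 < 3)%N.

Definition t12 : transposition := exist _ (tperm p1 p2) (is_transposition_tperm (isT : p1 != p2)).
Definition t13 : transposition := exist _ (tperm p1 p3) (is_transposition_tperm (isT : p1 != p3)).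
Definition t23 : transposition := exist _ (tperm p2 p3) (is_transposition_tperm (isT : p2 != p3)).

(* inl t is the generator H_t and inr i the generator a_i. *)
Definition A1gen : choiceType := ({perm 'I_3} + transposition)%type.

(* The relations l = r, as pairs of elements of any k-algebra with a chosen
   image of each generator.  MathComp multiplies permutations from left to
   right: the composite "s, then t" of functions, written ts, is (s * t)%g, and
   t i t^-1 is (i ^ t)%g. *)
Section Relations.
Variables (B : algType k) (H : {perm 'I_3} -> B) (a : transposition -> B).

Inductive A1rel : B -> B -> Prop :=
| A1rel_one : A1rel (H 1%g) 1
| A1rel_mul t s : A1rel (H t * H s) (H (s * t)%g)
| A1rel_conj t (i j : transposition) : val j = (val i ^ t)%g ->
    A1rel (H t * a i) ((-1) ^+ odd_perm t *: (a j * H t))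
| A1rel_sq : A1rel (a t12 ^+ 2) 0
| A1rel_quad : A1rel (a t12 * a t23 + a t23 * a t13 + a t13 * a t12)
                     (1 - H (val t12) * H (val t23)).

End Relations.

Lemma A1rel_morph (B C : algType k) (phi : {lrmorphism B -> C}) H a H' a' l r :
  (forall t, phi (H t) = H' t) -> (forall i, phi (a i) = a' i) ->
  A1rel H a l r -> A1rel H' a' (phi l) (phi r).
Proof.
move=> eH ea; case=> [|t s|t i j ij||].
- by rewrite rmorph1 eH; apply: A1rel_one.
- by rewrite rmorphM /= !eH; apply: A1rel_mul.
- by rewrite linearZ !rmorphM /= !eH !ea; apply: A1rel_conj.
- by rewrite raddf0 rmorphXn /= ea; apply: A1rel_sq.
- by rewrite raddfB !raddfD /= rmorph1 !rmorphM /= !eH !ea; apply: A1rel_quad.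
Qed.

Local Notation F := (freealg k A1gen).

Definition freeH (t : {perm 'I_3}) : F := fgen k (inl t : A1gen).
Definition freea (i : transposition) : F := fgen k (inr i : A1gen).

Definition A1ideal_gen (x : F) : Prop :=
  exists l r, A1rel freeH freea l r /\ x = l - r.

Definition A1 : Type := quotalg A1ideal_gen.

HB.instance Definition _ := GRing.PzRing.on A1.
HB.instance Definition _ := GRing.Lmodule.on A1.

Definition Hg (t : {perm 'I_3}) : A1 := qpi A1ideal_gen (freeH t).
Definition ag (i : transposition) : A1 := qpi A1ideal_gen (freea i).

Record A1rep := {
  A1rep_dim : nat;
  repH : {perm 'I_3} -> 'M[k]_A1rep_dim.+1;
  repa : transposition -> 'M[k]_A1rep_dim.+1;
  rep_rel : forall l r, A1rel repH repa l r -> l = r }.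

Section Rep.
Variable r : A1rep.
Local Notation n := (A1rep_dim r).

Definition rep_gen (g : A1gen) : 'M[k]_n.+1 :=
  match g with inl t => repH r t | inr i => repa r i end.

Lemma rep_gen_ideal x : A1ideal_gen x -> feval rep_gen x = 0.
Proof.
case=> l [r' [lr ->]]; rewrite raddfB /=; apply/eqP; rewrite subr_eq0; apply/eqP.
apply: (@rep_rel r); apply: (A1rel_morph (phi := feval rep_gen)) lr => [t|i];
  exact: feval_gen.
Qed.

Definition rep_eval : A1 -> 'M[k]_n.+1 :=
  @qlift k F A1ideal_gen 'M[k]_n.+1 (feval rep_gen).

HB.instance Definition _ := GRing.isZmodMorphism.Build A1 'M[k]_n.+1 rep_eval
  (qliftB rep_gen_ideal).
HB.instance Definition _ := GRing.isMonoidMorphism.Build A1 'M[k]_n.+1 rep_eval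
  (qliftM rep_gen_ideal).
HB.instance Definition _ := GRing.isScalable.Build k A1 'M[k]_n.+1 *:%R rep_eval
  (qliftZ rep_gen_ideal).

Lemma rep_evalH t : rep_eval (Hg t) = repH r t.
Proof. by rewrite /rep_eval (qlift_qpi rep_gen_ideal) /= feval_gen. Qed.

Lemma rep_evala i : rep_eval (ag i) = repa r i.
Proof. by rewrite /rep_eval (qlift_qpi rep_gen_ideal) /= feval_gen. Qed.

Definition repmod : Type := 'cV[k]_n.+1.

HB.instance Definition _ := GRing.Zmodule.on repmod.

Definition repmod_scale (x : A1) (v : repmod) : repmod := rep_eval x *m v.

Lemma repmod_scaleA x y v :
  repmod_scale x (repmod_scale y v) = repmod_scale (x * y) v.
Proof. by rewrite /repmod_scale mulmxA rmorphM. Qed.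

Lemma repmod_scale1 : left_id 1 repmod_scale.
Proof. by move=> v; rewrite /repmod_scale rmorph1 mul1mx. Qed.

Lemma repmod_scaleDr : right_distributive repmod_scale +%R.
Proof. by move=> x u v; rewrite /repmod_scale mulmxDr. Qed.

Lemma repmod_scaleDl v : {morph repmod_scale^~ v : x y / x + y}.
Proof. by move=> x y; rewrite /repmod_scale raddfD mulmxDl. Qed.

HB.instance Definition _ := GRing.Zmodule_isLmodule.Build A1 repmod
  repmod_scaleA repmod_scale1 repmod_scaleDr repmod_scaleDl.

Lemma repmodH t (v : repmod) : Hg t *: v = repH r t *m v.
Proof. by rewrite -rep_evalH. Qed.

Lemma repmoda i (v : repmod) : ag i *: v = repa r i *m v.
Proof. by rewrite -rep_evala. Qed.

End Rep.

Lemma rep_eps_rel l r :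
  @A1rel 'M[k]_1 (fun=> 1) (fun=> 0) l r -> l = r.
Proof.
by case=> *; rewrite ?mulr1 ?mul0r ?mulr0 ?scaler0 ?expr0n ?addr0 ?subrr.
Qed.

Definition rep_eps : A1rep :=
  {| A1rep_dim := 0; repH := fun=> 1; repa := fun=> 0; rep_rel := rep_eps_rel |}.

Definition sgnmx (t : {perm 'I_3}) : 'M[k]_1 := (-1) ^+ odd_perm t.

Lemma rep_sgn_rel l r : @A1rel 'M[k]_1 sgnmx (fun=> 0) l r -> l = r.
Proof.
rewrite /sgnmx; case=> [|t s|t i j _||].
- by rewrite odd_perm1.
- by rewrite odd_permM addbC signr_addb.
- by rewrite mulr0 mul0r scaler0.
- by rewrite expr0n.
- by rewrite !mul0r !addr0 !odd_tperm /= expr1 mulrNN mulr1 subrr.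
Qed.

Definition rep_sgn : A1rep :=
  {| A1rep_dim := 0; repH := sgnmx; repa := fun=> 0; rep_rel := rep_sgn_rel |}.

(* W_st is the hyperplane of sum zero in the permutation module k^3, with basis
   v = e_1 - e_3 and w = e_2 - e_3: as H_t e_j = e_(t j), the coordinates of
   H_t v and H_t w are read on e_1 and e_2.  Row and column 0 belong to v, row
   and column 1 to w. *)
Definition pt (i : 'I_2) : 'I_3 := widen_ord (leqnSn 2) i.

Definition Hst (t : {perm 'I_3}) : 'M[k]_2 :=
  \matrix_(i, j) ((t (pt j) == pt i)%:R - (t p3 == pt i)%:R).

(* a_13 and a_23 are determined by the action A of a_12. *)
Definition ast (A : 'M[k]_2) (i : transposition) : 'M[k]_2 :=
  if i == t12 then A
  else if i == t13 then - (Hst (val t23) * A * Hst (val t23))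
  else - (Hst (val t13) * A * Hst (val t13)).

Definition mat2 (a b c d : k) : 'M[k]_2 :=
  \matrix_(i, j) if i == 0 then if j == 0 then a else b
                 else if j == 0 then c else d.

Lemma mat2P (A B : 'M[k]_2) :
  A 0 0 = B 0 0 -> A 0 1 = B 0 1 -> A 1 0 = B 1 0 -> A 1 1 = B 1 1 -> A = B.
Proof.
move=> e00 e01 e10 e11; apply/matrixP => i j.
have I2 (x : 'I_2) : x = 0 \/ x = 1.
  by case: x => [[|[|//]] h]; [left | right]; apply: val_inj.
by case: (I2 i) => ->; case: (I2 j) => ->.
Qed.

Lemma mat2M a b c d a' b' c' d' : mat2 a b c d * mat2 a' b' c' d' =
  mat2 (a * a' + b * c') (a * b' + b * d') (c * a' + d * c') (c * b' + d * d').
Proof. by apply: mat2P; rewrite !mxE !big_ord_recl big_ord0 !mxE /= addr0. Qed.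

Lemma mat2D a b c d a' b' c' d' : mat2 a b c d + mat2 a' b' c' d' =
  mat2 (a + a') (b + b') (c + c') (d + d').
Proof. by apply: mat2P; rewrite !mxE. Qed.

Lemma mat2N a b c d : - mat2 a b c d = mat2 (- a) (- b) (- c) (- d).
Proof. by apply: mat2P; rewrite !mxE. Qed.

Lemma mat21 : 1 = mat2 1 0 0 1.
Proof. by apply: mat2P; rewrite !mxE. Qed.

Lemma mat20 : 0 = mat2 0 0 0 0.
Proof. by apply: mat2P; rewrite !mxE. Qed.

Lemma Hst12 : Hst (val t12) = mat2 0 1 1 0.
Proof. by apply: mat2P; rewrite !mxE !permE /= ?subr0 ?sub0r. Qed.

Lemma Hst23 : Hst (val t23) = mat2 1 0 (- 1) (- 1).
Proof. by apply: mat2P; rewrite !mxE !permE /= ?subr0 ?sub0r. Qed.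

Lemma Hst13 : Hst (val t13) = mat2 (- 1) (- 1) 0 1.
Proof. by apply: mat2P; rewrite !mxE !permE /= ?subr0 ?sub0r. Qed.

Lemma Hst1 : Hst 1%g = 1.
Proof. by rewrite mat21; apply: mat2P; rewrite !mxE !permE /= ?subr0 ?sub0r. Qed.

Lemma HstM t s : Hst t * Hst s = Hst (s * t)%g.
Proof.
have sum3 (f : 'I_3 -> k) : \sum_j f j = f p1 + f p2 + f p3.
  rewrite !big_ord_recl big_ord0 addr0 addrA.
  by congr (f _ + f _ + f _); apply: val_inj.
have sum2 (f : 'I_2 -> k) : \sum_j f j = f 0 + f 1.
  by rewrite !big_ord_recl big_ord0 addr0; congr (f _ + f _); apply: val_inj.
have pick (x y : 'I_3) : (t y == x)%:R = \sum_j (t j == x)%:R * (y == j)%:R :> k.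
  rewrite (bigD1 y) //= eqxx mulr1 big1 ?addr0 // => j /negbTE.
  by rewrite eq_sym => ->; rewrite mulr0.
apply/matrixP => i j; rewrite !mxE !permM (pick _ (s (pt j))) (pick _ (s p3)).
rewrite sum2 !mxE !sum3.
have -> : pt 0 = p1 by apply: val_inj.
have -> : pt 1 = p2 by apply: val_inj.
have one x : (x == p3)%:R = 1 - (x == p1)%:R - (x == p2)%:R :> k.
  by case: x => [[|[|[|//]]] h]; rewrite -!val_eqE /= ?subr0 ?subrr ?sub0r.
rewrite !one; ring.
Qed.

Lemma transpositionP (i : transposition) : [\/ i = t12, i = t13 | i = t23].
Proof.
case: i => t it; case/existsP: (it) => x /existsP [y /andP [xy /eqP tE]].
case: x y xy tE => [[|[|[|//]]] hx] [[|[|[|//]]] hy] //= _ tE;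
  [ constructor 1 | constructor 2 | constructor 1
  | constructor 3 | constructor 2 | constructor 3]; apply: val_inj => /=;
  rewrite tE (bool_irrelevance hx isT) (bool_irrelevance hy isT) //;
  exact: tpermC.
Qed.

Section StandardRep.
Variables a b : k.
Let A := mat2 a b (- b) (- a).

Lemma ast12 : ast A t12 = A. Proof. by rewrite /ast eqxx. Qed.

Lemma ast13 : ast A t13 = mat2 (b - a) b (2 * a - 2 * b) (a - b).
Proof.
rewrite /ast ifN ?eqxx; last first.
  apply/eqP => /(congr1 (fun t : transposition => val (val t p1))).
  by rewrite /= !permE.
by rewrite Hst23 !mat2M mat2N; congr mat2; ring.
Qed.

Lemma ast23 : ast A t23 = mat2 (b - a) (2 * b - 2 * a) (- b) (a - b).
Proof.
rewrite /ast !ifN; first last.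
- apply/eqP => /(congr1 (fun t : transposition => val (val t p1))).
  by rewrite /= !permE.
- apply/eqP => /(congr1 (fun t : transposition => val (val t p1))).
  by rewrite /= !permE.
by rewrite Hst13 !mat2M mat2N; congr mat2; ring.
Qed.

Lemma ast_tperm (t i j : transposition) : val j = (val i ^ val t)%g ->
  Hst (val t) * ast A i = - (ast A j * Hst (val t)).
Proof.
have HE := (Hst12, Hst13, Hst23, ast12, ast13, ast23).
case: (transpositionP t) => ->; case: (transpositionP i) => ->;
  case: (transpositionP j) => -> e; rewrite ?HE ?mat2M ?mat2N;
  try (congr mat2; ring);
  move: (congr1 (fun s : {perm 'I_3} => (val (s p1), val (s p2))) e);
  by rewrite /= tpermJ !permE.
Qed.

Lemma ast_conj t (i j : transposition) : val j = (val i ^ t)%g ->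
  Hst t * ast A i = (-1) ^+ odd_perm t *: (ast A j * Hst t).
Proof.
have [ts -> /allP dts] := prod_tpermP t.
elim: ts dts i j => [|[x y] ts IH] dts i j.
  rewrite big_nil conjg1 => /val_inj ->.
  by rewrite Hst1 odd_perm1 scale1r mul1r mulr1.
rewrite big_cons -HstM conjgM => jE.
have xy : x != y by apply: (dts (x, y)); rewrite inE eqxx.
pose u : transposition := exist _ (tperm x y) (is_transposition_tperm xy).
have it : is_transposition (val i ^ tperm x y)%g.
  case: i {jE} => _ /= /existsP [z /existsP [w /andP [zw /eqP ->]]].
  by rewrite tpermJ is_transposition_tperm // (inj_eq perm_inj).
pose i' : transposition := exist (fun s => is_true (is_transposition s)) _ it.
have dts' : {in ts, forall p, dpair p}.
  by move=> p pts; apply: dts; rewrite inE pts orbT.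
rewrite -mulrA (@ast_tperm u i i') // mulrN.
rewrite [_ * (ast A i' * _)]mulrA (IH dts' i' j jE).
rewrite odd_permM odd_tperm xy signr_addb expr1 mulN1r scaleNr.
by rewrite -scalerAl -mulrA.
Qed.

Lemma ast_rel : a ^+ 2 = b ^+ 2 ->
  A * ast A t23 + ast A t23 * ast A t13 + ast A t13 * A
    = 1 - Hst (val t12) * Hst (val t23) ->
  forall l r, A1rel Hst (ast A) l r -> l = r.
Proof.
move=> ab quad l r; case=> [|t s|t i j|| ].
- exact: Hst1.
- exact: HstM.
- exact: ast_conj.
- rewrite ast12 expr2 mat2M mat20; congr mat2; ring: ab.
- by rewrite ast12.
Qed.

End StandardRep.

(* Action of a_12 in S_st(theta): st_mx1 for theta^2 = -1, and st_mx2 for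
   theta^2 = -1/9; see st_mx1E and st_mx2E for its values on v and w. *)
Definition st_mx1 (theta : k) := mat2 theta theta (- theta) (- theta).
Definition st_mx2 (theta : k) := mat2 theta (- theta) theta (- theta).

Lemma st_mx1_rel theta : theta ^+ 2 = -1 ->
  forall l r, A1rel Hst (ast (st_mx1 theta)) l r -> l = r.
Proof.
move=> h; apply: ast_rel => //; rewrite ast13 ast23 Hst12 Hst23 !mat2M mat21.
rewrite mat2N !mat2D; congr mat2; ring: h.
Qed.

Lemma st_mx2_rel theta : 9 * theta ^+ 2 = -1 ->
  forall l r, A1rel Hst (ast (st_mx2 theta)) l r -> l = r.
Proof.
move=> h; have := @ast_rel theta (- theta).
rewrite ast13 ast23 !opprK; apply; first by rewrite sqrrN.
have lc (c x y : k) : x - y = c * (9 * theta ^+ 2 + 1) -> x = y.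
  by rewrite h addNr mulr0 => /subr0_eq.
rewrite Hst12 Hst23 !mat2M mat21 mat2N !mat2D; congr mat2.
- by apply: (lc (-2)); ring.
- by apply: (lc (-1)); ring.
- by apply: (lc 1); ring.
- by apply: (lc (-1)); ring.
Qed.

Definition st_v : 'cV[k]_2 := delta_mx 0 0.
Definition st_w : 'cV[k]_2 := delta_mx 1 0.

Lemma mat2_v a b c d : mat2 a b c d *m st_v = a *: st_v + c *: st_w.
Proof.
apply/matrixP => x y; rewrite !mxE !big_ord_recl big_ord0 !mxE.
by case: x => [[|[|//]] h]; rewrite (ord1 y) /= !(mulr0, mulr1, addr0, add0r).
Qed.

Lemma mat2_w a b c d : mat2 a b c d *m st_w = b *: st_v + d *: st_w.
Proof.
apply/matrixP => x y; rewrite !mxE !big_ord_recl big_ord0 !mxE.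
by case: x => [[|[|//]] h]; rewrite (ord1 y) /= !(mulr0, mulr1, addr0, add0r).
Qed.

Lemma Hst_basisE :
  [/\ Hst (val t12) *m st_v = st_w /\ Hst (val t12) *m st_w = st_v,
      Hst (val t23) *m st_v = st_v - st_w /\ Hst (val t23) *m st_w = - st_w
    & Hst (val t13) *m st_v = - st_v /\ Hst (val t13) *m st_w = - st_v + st_w].
Proof.
rewrite Hst12 Hst23 Hst13 !mat2_v !mat2_w.
by rewrite !scaleN1r !scale1r !scale0r !addr0 !add0r.
Qed.

Lemma st_mx1E theta :
  st_mx1 theta *m st_v = theta *: (st_v - st_w) /\
  st_mx1 theta *m st_w = theta *: (st_v - st_w).
Proof. by rewrite mat2_v mat2_w scalerBr scaleNr. Qed.

Lemma st_mx2E theta :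
  st_mx2 theta *m st_v = theta *: (st_v + st_w) /\
  st_mx2 theta *m st_w = - theta *: (st_v + st_w).
Proof. by rewrite mat2_v mat2_w !scalerDr. Qed.

Definition rep_st1 theta (h : theta ^+ 2 = -1) : A1rep :=
  {| A1rep_dim := 1; repH := Hst; repa := ast (st_mx1 theta);
     rep_rel := st_mx1_rel h |}.
Definition rep_st2 theta (h : 9 * theta ^+ 2 = -1) : A1rep :=
  {| A1rep_dim := 1; repH := Hst; repa := ast (st_mx2 theta);
     rep_rel := st_mx2_rel h |}.

Lemma A1_oner_neq0 : (1 : A1) != 0.
Proof.
apply/eqP => /(congr1 (rep_eval rep_eps)); rewrite rmorph1 raddf0.
by move/eqP; rewrite oner_eq0.
Qed.

HB.instance Definition _ := GRing.PzSemiRing_isNonZero.Build A1 A1_oner_neq0.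
HB.instance Definition _ := GRing.Lmodule_isLalgebra.Build k A1
  (@quotalg_scalerAl k F A1ideal_gen).
HB.instance Definition _ := GRing.Lalgebra_isAlgebra.Build k A1
  (@quotalg_scalerAr k F A1ideal_gen).

Lemma A1_rel l r : A1rel Hg ag l r -> l = r.
Proof.
pose pi : F -> A1 := qpi A1ideal_gen.
have piM x y : pi x * pi y = pi (x * y) by rewrite [RHS]rmorphM.
have piD x y : pi x + pi y = pi (x + y) by rewrite [RHS]rmorphD.
have piB x y : pi x - pi y = pi (x - y) by rewrite [RHS]rmorphB.
have piZ c x : c *: pi x = pi (c *: x) by rewrite [RHS]qpiZ.
have pi1 : 1 = pi 1 by rewrite [RHS]rmorph1.
have pi0 : 0 = pi 0 by rewrite [RHS]rmorph0.
have rel x y : A1rel freeH freea x y -> pi x = pi y.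
  by move=> xy; apply/qpiP/gen_ideal_incl; exists x, y.
have HE t : Hg t = pi (freeH t) by [].
have aE i : ag i = pi (freea i) by [].
case=> [|t s|t i j ij||]; rewrite ?expr2 ?HE ?aE ?piM ?piZ ?pi1 ?pi0 ?piD ?piB.
- exact/rel/A1rel_one.
- exact/rel/A1rel_mul.
- exact/rel/A1rel_conj.
- exact/rel/A1rel_sq.
- exact/rel/A1rel_quad.
Qed.

Inductive simple_label :=
  L_eps | L_sgn | L_st_i | L_st_Ni | L_st_i3 | L_st_Ni3.

Section Labels.
Variable (i : k).
Hypotheses (char0 : [pchar k] =i pred0) (i2 : i ^+ 2 = -1).

Lemma sqr_Ni : (- i) ^+ 2 = -1.
Proof. by rewrite sqrrN. Qed.

Lemma sqr_i3 : 9 * (i / 3) ^+ 2 = -1.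
Proof.
have n3 : 3 != 0 :> k by rewrite (pcharf0P k).1.
by rewrite expr_div_n i2; field; rewrite (pcharf0P k).1.
Qed.

Lemma sqr_Ni3 : 9 * (- (i / 3)) ^+ 2 = -1.
Proof. by rewrite sqrrN sqr_i3. Qed.

Definition label_rep (l : simple_label) : A1rep :=
  match l with
  | L_eps => rep_eps
  | L_sgn => rep_sgn
  | L_st_i => rep_st1 i2
  | L_st_Ni => rep_st1 sqr_Ni
  | L_st_i3 => rep_st2 sqr_i3
  | L_st_Ni3 => rep_st2 sqr_Ni3
  end.

Definition simple_A1 (l : simple_label) : lmodType A1 := repmod (label_rep l).

End Labels.
End A1.

Definition simple_module (R : pzRingType) (M : lmodType R) : Prop :=
  (exists x : M, x != 0) /\
  forall N : {pred M}, submod_closed N -> N =i pred1 0 \/ N =i predT.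

Definition isomorphic (R : pzRingType) (M N : lmodType R) : Prop :=
  exists f : {linear M -> N}, bijective f.

(* Main.v *)
From HB Require Import structures.
Require Import Defs.
From mathcomp Require Import all_boot all_order all_algebra.
From mathcomp Require Import all_fingroup boolp.
From mathcomp.multinomials Require Import monalg.
From mathcomp Require Import ring.

(* Let w be a primitive cube root of unity, h = H_12, g = H_12 H_23, and let
   A_j = a_12 + w^(2j) a_23 + w^j a_13 be the Fourier transform of the a_i under
   conjugation by g.  Then A_j shifts the weights of g by j, conjugation by h maps
   A_j to - A_(-j), and the quadratic relations say what A_0 A_0, A_1 A_2 and
   A_2 A_1 are on each weight space M_j of g: A_0 A_0 is 0 on M_0 and 3 on M_1
   and M_2, A_2 A_1 is -3 on M_1, and so on.
   Hence any nonzero module contains either a nonzero n in M_0 killed by all A_j,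
   and then n + h n or n spans a copy of S_eps or S_sgn, or a nonzero p in M_1
   with A_2 p = A_2 A_0 p = 0.  The space of these p is stable under the commuting
   operators A_0 and h A_1, which both square to 3 there, so it contains a common
   eigenvector p; then p and h p span a copy of a module
   S_st(theta), the pair of eigenvalues determining theta among four values.
   The six modules are told apart by their annihilators. *)

Import GRing.Theory.
Local Open Scope ring_scope.

(** * Linear arithmetic in modules *)

(* The square-zero extension [k (+) V] is a commutative ring in which [V] embeds,
   so [ring] proves linear identities in [V]. *)
Section TrivialExtension.
Variables (k : comNzRingType) (V : lmodType k).

Definition trivext : Type := (k * V)%type.
HB.instance Definition _ := GRing.Zmodule.on trivext.

Definition te_one : trivext := (1, 0).
Definition te_mul (a b : trivext) : trivext := (a.1 * b.1, a.1 *: b.2 + b.1 *: a.2).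

Lemma te_mulA : associative te_mul.
Proof.
move=> a b c; rewrite /te_mul /= !scalerDr !scalerA mulrA addrA.
by congr (_, _ + _ + _); congr (_ *: _); rewrite mulrC.
Qed.

Lemma te_mulC : commutative te_mul.
Proof. by move=> a b; rewrite /te_mul mulrC addrC. Qed.

Lemma te_mul1 : left_id te_one te_mul.
Proof. by case=> a u; rewrite /te_mul /= mul1r scale1r scaler0 addr0. Qed.

Lemma te_mulDl : left_distributive te_mul +%R.
Proof.
move=> a b c; congr (_, _); first exact: mulrDl.
by rewrite /= scalerDl scalerDr addrACA.
Qed.

HB.instance Definition _ :=
  GRing.Zmodule_isComPzRing.Build trivext te_mulA te_mulC te_mul1 te_mulDl.

Definition te_scal (c : k) : trivext := (c, 0).
Definition te_vec (v : V) : trivext := (0, v).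

Lemma te_scalB : zmod_morphism te_scal.
Proof. by move=> a b; congr (_, _); rewrite /= subr0. Qed.
Lemma te_scalM : monoid_morphism te_scal.
Proof. by split=> // a b; congr (_, _); rewrite /= !scaler0 addr0. Qed.
Lemma te_vecB : zmod_morphism te_vec.
Proof. by move=> a b; congr (_, _); rewrite /= subr0. Qed.

HB.instance Definition _ := GRing.isZmodMorphism.Build k trivext te_scal te_scalB.
HB.instance Definition _ := GRing.isMonoidMorphism.Build k trivext te_scal te_scalM.
HB.instance Definition _ := GRing.isZmodMorphism.Build V trivext te_vec te_vecB.

Lemma te_vecZ c v : te_vec (c *: v) = te_scal c * te_vec v.
Proof. by congr (_, _); rewrite /= ?mulr0 // scale0r addr0. Qed.

Lemma te_vec_inj : injective te_vec.
Proof. by move=> u v []. Qed.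

End TrivialExtension.

Ltac lmod_ring :=
  apply: te_vec_inj;
  rewrite ?(raddfD, raddfN, raddf0, raddfMn) /= ?te_vecZ; ring.

(** The scalar equation [e] is carried by [te_scal] into the extension, where [ring] can compute
    modulo it. *)
Ltac lmod_ring_mod e :=
  apply: te_vec_inj;
  rewrite ?(raddfD, raddfN, raddf0, raddfMn) /= ?te_vecZ;
  match goal with
  | |- context [te_vec ?k ?V _] => ring: (congr1 (te_scal k V) e)
  end.

(** * Special vectors in a nonzero module *)

Section Weights.
Variables (k : fieldType) (V : lmodType k) (w s : k).
Hypotheses (n3 : 3 != 0 :> k) (w2 : w ^+ 2 = - w - 1) (s2 : s ^+ 2 = 3).

(** On [p] the product of [f - s] and [f + s] vanishes: either [f + s] already kills [p], or
    [f p + s *: p] is an eigenvector for [s]. The last clause lets linear conditions shared by [p]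
    and [f p] pass to [q]. *)
Lemma sqr3_eigenvector (f : {linear V -> V}) (p : V) :
  p != 0 -> f (f p) = 3 *: p ->
  exists2 c, c = s \/ c = - s &
  exists q, [/\ q != 0, f q = c *: q & q = p \/ q = f p + s *: p].
Proof.
move=> p0 ffp; have [e|ne] := eqVneq (f p + s *: p) 0.
  exists (- s); first by right.
  exists p; split=> //; last by left.
  by rewrite scaleNr; apply/eqP; rewrite -addr_eq0 e.
exists s; first by left.
exists (f p + s *: p); split=> //; last by right.
by rewrite linearD linearZ /= ffp -s2; lmod_ring.
Qed.

Variables (A0 A1 A2 g h : {linear V -> V}).
Hypotheses
  (A00 : forall v, A0 (A0 v) = 2 *: v - g v - g (g v))
  (A12 : forall v, A1 (A2 v) = w *: (v - g v) + w ^+ 2 *: (v - g (g v)))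
  (A21 : forall v, A2 (A1 v) = w ^+ 2 *: (v - g v) + w *: (v - g (g v)))
  (A01 : forall v, A0 (A1 v) + A1 (A0 v) + A2 (A2 v) = 0)
  (A02 : forall v, A0 (A2 v) + A2 (A0 v) + A1 (A1 v) = 0)
  (gA0 : forall v, g (A0 v) = A0 (g v))
  (gA1 : forall v, g (A1 v) = w *: A1 (g v))
  (gA2 : forall v, g (A2 v) = w ^+ 2 *: A2 (g v))
  (hA0 : forall v, h (A0 v) = - A0 (h v))
  (hA1 : forall v, h (A1 v) = - A2 (h v))
  (hA2 : forall v, h (A2 v) = - A1 (h v))
  (hh : forall v, h (h v) = v)
  (ggg : forall v, g (g (g v)) = v)
  (hg : forall v, h (g v) = g (g (h v))).

Definition wt (c : k) (v : V) := g v = c *: v.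

Definition one_dim_vector (n : V) :=
  [/\ n != 0, g n = n, h n = n \/ h n = - n & [/\ A0 n = 0, A1 n = 0 & A2 n = 0]].

(** As [h] is an involution, [A1 p = m *: h p] makes [p] an eigenvector of [h A1] with eigenvalue
    [m]. *)
Definition two_dim_vector (l m : k) (p : V) :=
  [/\ p != 0, g p = w *: p, A0 p = l *: p, A1 p = m *: h p & A2 p = 0].

Lemma w3 : w ^+ 3 = 1. Proof. by rewrite exprS w2; ring: w2. Qed.

Lemma wtE c v : wt c v -> g v = c *: v /\ g (g v) = c ^+ 2 *: v.
Proof. by rewrite /wt => gv; rewrite gv linearZ_LR /= gv scalerA. Qed.

Lemma A00_0 v : wt 1 v -> A0 (A0 v) = 0.
Proof. by case/wtE=> gv ggv; rewrite A00 ggv gv; lmod_ring. Qed.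
Lemma A12_0 v : wt 1 v -> A1 (A2 v) = 0.
Proof. by case/wtE=> gv ggv; rewrite A12 ggv gv; lmod_ring. Qed.
Lemma A21_0 v : wt 1 v -> A2 (A1 v) = 0.
Proof. by case/wtE=> gv ggv; rewrite A21 ggv gv; lmod_ring. Qed.
Lemma A00_1 v : wt w v -> A0 (A0 v) = 3 *: v.
Proof. by case/wtE=> gv ggv; rewrite A00 ggv gv w2; lmod_ring. Qed.
Lemma A12_1 v : wt w v -> A1 (A2 v) = 0.
Proof. by case/wtE=> gv ggv; rewrite A12 ggv gv; lmod_ring_mod w2. Qed.
Lemma A21_1 v : wt w v -> A2 (A1 v) = - 3 *: v.
Proof. by case/wtE=> gv ggv; rewrite A21 ggv gv; lmod_ring_mod w2. Qed.
Lemma A12_2 v : wt (w ^+ 2) v -> A1 (A2 v) = - 3 *: v.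
Proof. by case/wtE=> gv ggv; rewrite A12 ggv gv; lmod_ring_mod w2. Qed.
Lemma A21_2 v : wt (w ^+ 2) v -> A2 (A1 v) = 0.
Proof. by case/wtE=> gv ggv; rewrite A21 ggv gv; lmod_ring_mod w2. Qed.

Lemma A0_wt c v : wt c v -> wt c (A0 v).
Proof. by rewrite /wt gA0 => ->; rewrite linearZ. Qed.
Lemma A1_wt c v : wt c v -> wt (c * w) (A1 v).
Proof. by rewrite /wt gA1 => ->; rewrite linearZ_LR scalerA mulrC. Qed.
Lemma A2_wt c v : wt c v -> wt (c * w ^+ 2) (A2 v).
Proof. by rewrite /wt gA2 => ->; rewrite linearZ_LR scalerA mulrC. Qed.

Lemma gh v : g (h v) = h (g (g v)).
Proof. by rewrite !hg !ggg. Qed.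
Lemma h_wt c v : wt c v -> wt (c ^+ 2) (h v).
Proof. by case/wtE=> gv ggv; rewrite /wt gh ggv linearZ. Qed.

(** If [m + h m] vanishes, then [h m = - m] and [m] itself serves. Otherwise [m + h m] is fixed by
    [h], and is still killed by the [A_j] because conjugation by [h] permutes them up to sign. *)
Lemma one_dim_vector_exists (m : V) :
  m != 0 -> wt 1 m -> A0 m = 0 -> A1 m = 0 -> A2 m = 0 ->
  exists n, one_dim_vector n.
Proof.
rewrite /wt scale1r => m0 gm A0m A1m A2m.
have [e|ne] := eqVneq (m + h m) 0.
  exists m; split=> //; right.
  by apply/eqP; rewrite -addr_eq0 addrC e.
exists (m + h m); split=> //.
- by rewrite linearD /= gh !gm.
- by left; rewrite linearD /= hh addrC.
- split; rewrite linearD /= ?A0m ?A1m ?A2m add0r; apply: oppr_inj.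
  + by rewrite -hA0 A0m raddf0 oppr0.
  + by rewrite -hA2 A2m raddf0 oppr0.
  + by rewrite -hA1 A1m raddf0 oppr0.
Qed.

Lemma two_dim_vector_exists (p : V) :
  p != 0 -> wt w p -> A2 p = 0 -> A2 (A0 p) = 0 ->
  exists l m p', [/\ l = s \/ l = - s, m = s \/ m = - s & two_dim_vector l m p'].
Proof.
move=> p0 wp A2p A20p.
(* An eigenvector [q] of [A0] is found first, then one of [h A1] in the span of [q] and
   [h (A1 q)]. *)
have [l ls [q [q0 A0q qE]]] := sqr3_eigenvector _ _ p0 (A00_1 _ wp).
have wq : wt w q.
  case: qE => -> //; rewrite /wt linearD linearZ_LR /=.
  by rewrite (A0_wt _ _ wp) wp; lmod_ring.
have A2q : A2 q = 0.
  by case: qE => -> //; rewrite linearD linearZ_LR /= A2p A20p scaler0 addr0.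
(* This yields [A2 (h (A1 q)) = 0], so that [A2] also kills the second eigenvector [r]. *)
have A11q : A1 (A1 q) = 0.
  by have := A02 q; rewrite A2q A0q linearZ_LR /= A2q linear0 scaler0 !add0r.
have hA1q : h (A1 (h (A1 q))) = 3 *: q.
  by rewrite hA1 hh A21_1 //; lmod_ring.
have [m ms [r [r0 hA1r rE]]] :=
  sqr3_eigenvector (h \o A1) _ q0 hA1q.
exists l, m, r; split=> //.
(* [A0] commutes with [h A1] on [q]: since [A2 q = 0], relation [A01] makes [A0] and [A1]
   anticommute there, and moving [A0] past [h] restores the sign. *)
have A0hA1q : A0 (h (A1 q)) = l *: h (A1 q).
  apply: oppr_inj; rewrite -hA0.
  have := A01 q; rewrite A2q linear0 addr0 A0q linearZ_LR /= => /eqP.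
  by rewrite addr_eq0 => /eqP ->; rewrite linearN /= linearZ.
have ghA1q : wt w (h (A1 q)).
  have := h_wt _ _ (A1_wt _ _ wq).
  by rewrite -expr2 -exprM (exprD w 3 1) w3 mul1r.
split=> //.
- by case: rE => ->//; rewrite linearD linearZ_LR /= wq ghA1q; lmod_ring.
- by case: rE => ->//; rewrite linearD linearZ_LR /= A0q A0hA1q; lmod_ring.
- by rewrite -linearZ_LR -hA1r /= hh.
- case: rE => ->//; rewrite linearD linearZ_LR /= A2q scaler0 addr0.
  by apply: oppr_inj; rewrite -hA1 A11q linear0 oppr0.
Qed.

(** Once [A0 m = 0], three candidates are tried in turn: [m] if [A1 m = 0]; then [p = A1 m] if
    [A2 (A0 p) = 0]; finally [A2 (A0 p)], of weight [1], which the relations force to be killed by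
    every [A_j]. *)
Lemma special_vector_of_wt1 (m : V) : m != 0 -> wt 1 m ->
  (exists n, one_dim_vector n) \/
  exists l m p, [/\ l = s \/ l = - s, m = s \/ m = - s & two_dim_vector l m p].
Proof.
(* [A0] squares to zero on weight [1], so a nonzero [A0 m] can replace [m]. *)
wlog A0m : m / A0 m = 0 => [IH m0 wm|m0 wm].
  have [A0m|A0m] := eqVneq (A0 m) 0; first exact: (IH m).
  by apply: (IH (A0 m)) => //; [apply: A00_0 | apply: A0_wt].
have wA1m : wt w (A1 m) by rewrite -[w]mul1r; apply: A1_wt.
have wA2m : wt (w ^+ 2) (A2 m) by rewrite -[w ^+ 2]mul1r; apply: A2_wt.
have A10m : A2 (A2 m) = - A0 (A1 m).
  have := A01 m; rewrite A0m linear0 addr0 addrC => /eqP.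
  by rewrite addr_eq0 => /eqP.
have [p0|p0] := eqVneq (A1 m) 0.
  left; apply: (one_dim_vector_exists m) => //.
  (* It remains to see that [A2 m = 0]: [A1 A2] acts by [-3] on [A2 m], while
     [A2 (A2 m) = - A0 (A1 m)] is zero. *)
  have := A12_2 _ wA2m; rewrite A10m p0 !linear0 ?oppr0 ?linear0 => /esym/eqP.
  by rewrite scaler_eq0 oppr_eq0 (negbTE n3) => /eqP.
set p := A1 m in wA1m p0 A10m.
have A2p : A2 p = 0 by apply: A21_0.
have A11p : A1 (A1 p) = - A2 (A0 p).
  by have := A02 p; rewrite A2p linear0 add0r addrC => /eqP; rewrite addr_eq0 => /eqP.
have [n0|n0] := eqVneq (A2 (A0 p)) 0.
  by right; apply: (two_dim_vector_exists p).
left; apply: (one_dim_vector_exists (A2 (A0 p))) => //.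
- by have := A2_wt _ _ (A0_wt _ _ wA1m); rewrite -exprS w3.
- have A10p : A1 (A0 p) = 3 *: A2 m.
    have -> : A0 p = - A2 (A2 m) by rewrite A10m opprK.
    by rewrite linearN /= A12_2 // -scaleNr opprK.
  have := A02 (A0 p); rewrite (A00_1 _ wA1m) linearZ_LR /= A2p scaler0 addr0.
  by rewrite A10p linearZ_LR /= A12_0 // scaler0 addr0.
- by apply: A12_1; apply: A0_wt.
- apply: oppr_inj; rewrite oppr0 -linearN /= -A11p; apply: A21_2.
  by have := A1_wt _ _ wA1m.
Qed.

(** [A2 p] and [A2 (A0 p)] have weight [1]; if one of them is nonzero, the weight [1] case applies
    to it. *)
Lemma special_vector_of_wtw (p : V) : p != 0 -> wt w p ->
  (exists n, one_dim_vector n) \/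
  exists l m p, [/\ l = s \/ l = - s, m = s \/ m = - s & two_dim_vector l m p].
Proof.
move=> p0 wp; have wA2 q : wt w q -> wt 1 (A2 q).
  by move/A2_wt; rewrite -exprS w3.
have [A2p|/special_vector_of_wt1] := eqVneq (A2 p) 0; last by apply; apply: wA2.
have [A20p|/special_vector_of_wt1] := eqVneq (A2 (A0 p)) 0; last first.
  by apply; apply/wA2/A0_wt.
by right; apply: (two_dim_vector_exists p).
Qed.

Lemma special_vector_exists (v : V) : v != 0 ->
  (exists n, one_dim_vector n) \/
  exists l m p, [/\ l = s \/ l = - s, m = s \/ m = - s & two_dim_vector l m p].
Proof.
(* For a cube root of unity [c], [v_ c] is three times the component of [v] of weight [c]; these
   cannot all vanish. *)
move=> v0; pose v_ c := v + c ^+ 2 *: g v + c *: g (g v).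
have wv c : c ^+ 3 = 1 -> wt c (v_ c).
  move=> c3; rewrite /wt /v_ !(linearD g) !(linearZ_LR g) /= ggg.
  by lmod_ring_mod c3.
have w4 : (w ^+ 2) ^+ 2 = w by rewrite -exprM (exprD w 3 1) w3 mul1r.
have [e0|n0] := eqVneq (v_ 1) 0.
  have [e1|n1] := eqVneq (v_ w) 0.
    have [e2|n2] := eqVneq (v_ (w ^+ 2)) 0.
      have : v_ 1 + v_ w + v_ (w ^+ 2) = 3 *: v.
        by rewrite /v_ w4; lmod_ring_mod w2.
      rewrite e0 e1 e2 !add0r => /esym/eqP.
      by rewrite scaler_eq0 (negbTE n3) (negbTE v0).
    (* [h] exchanges the weights [w ^+ 2] and [w]. *)
    apply: (special_vector_of_wtw (h (v_ (w ^+ 2)))).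
      by apply: contraNneq n2 => hv; rewrite -[v_ _]hh hv linear0.
    by have := h_wt _ _ (wv (w ^+ 2) _); rewrite w4; apply; rewrite exprAC w3 expr1n.
  by apply: (special_vector_of_wtw _ n1); apply: wv w3.
by apply: (special_vector_of_wt1 _ n0); apply: wv; rewrite expr1n.
Qed.
End Weights.

(** * Relations between the Fourier transforms of the generators *)

Section Relations.
Variables (k : fieldType) (B : algType k) (x y z h h' : B).
Hypotheses (hh : h * h = 1) (h'h' : h' * h' = 1) (braid : h * h' * h = h' * h * h').
Hypotheses (hx : h * x = - (x * h)) (hy : h * y = - (z * h)) (hz : h * z = - (y * h)).
Hypotheses (h'x : h' * x = - (z * h')) (h'y : h' * y = - (y * h'))
  (h'z : h' * z = - (x * h')).
Hypotheses (xx : x * x = 0) (xyz : x * y + y * z + z * x = 1 - h * h').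
Local Notation g := (h * h').

Lemma cycle_sqr : g * g = h' * h.
Proof. by rewrite -!mulrA [h' * _]mulrA -braid !mulrA hh mul1r. Qed.
Lemma cycle_cube : g * (g * g) = 1.
Proof. by rewrite cycle_sqr -mulrA [h' * _]mulrA h'h' mul1r hh. Qed.
Lemma h_cycle : h * g = g * g * h.
Proof. by rewrite cycle_sqr mulrA hh mul1r -mulrA hh mulr1. Qed.
Lemma cycle_x : g * x = y * g.
Proof. by rewrite -mulrA h'x mulrN [h * (_ * _)]mulrA hz mulNr opprK -mulrA. Qed.
Lemma cycle_y : g * y = z * g.
Proof. by rewrite -mulrA h'y mulrN [h * (_ * _)]mulrA hy mulNr opprK -mulrA. Qed.
Lemma cycle_z : g * z = x * g.
Proof. by rewrite -mulrA h'z mulrN [h * (_ * _)]mulrA hx mulNr opprK -mulrA. Qed.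
Lemma cycle_reg u : u * g = 0 -> u = 0.
Proof. by move=> ug; rewrite -[u]mulr1 -cycle_cube [u * _]mulrA ug mul0r. Qed.
Lemma yy_eq0 : y * y = 0.
Proof. by apply: cycle_reg; rewrite -mulrA -cycle_x mulrA -cycle_x -mulrA xx mulr0. Qed.
Lemma zz_eq0 : z * z = 0.
Proof. by apply: cycle_reg; rewrite -mulrA -cycle_y mulrA -cycle_y -mulrA yy_eq0 mulr0. Qed.

(** Together with [quad_xz] this eliminates [x * y] and [x * z]; products of Fourier transforms are
    then compared linearly in the remaining monomials. *)
Lemma quad_xy : x * y = 1 - g - y * z - z * x.
Proof. by rewrite -xyz; lmod_ring. Qed.
(** This is the quadratic relation conjugated by [h], which up to sign fixes [x] and swaps [y] and
    [z], and which inverts [g]. *)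
Lemma quad_xz : x * z = 1 - g * g - z * y - y * x.
Proof.
have hM u v : h * (u * v) * h = h * u * h * (h * v * h).
  by rewrite !mulrA -[_ * h * h]mulrA hh mulr1.
have xh : h * x * h = - x by rewrite hx mulNr -mulrA hh mulr1.
have yh : h * y * h = - z by rewrite hy mulNr -mulrA hh mulr1.
have zh : h * z * h = - y by rewrite hz mulNr -mulrA hh mulr1.
have := congr1 (fun u => h * u * h) xyz.
rewrite mulrBr mulrBl h_cycle -[g * g * h * h]mulrA mulr1 hh mulr1.
rewrite !mulrDr !mulrDl !hM xh yh zh !mulrNN => <-; lmod_ring.
Qed.

Variable w : k.
Hypothesis w2 : w ^+ 2 = - w - 1.
(* [x], [y], [z] play the roles of [a_12], [a_23], [a_13]. *)
Definition fourier0 : B := x + y + z.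
Definition fourier1 : B := x + w ^+ 2 *: y + w *: z.
Definition fourier2 : B := x + w *: y + w ^+ 2 *: z.

Ltac expand := rewrite ?(mulrDl, mulrDr) -?(scalerAl, scalerAr).

Lemma fourier00 : fourier0 * fourier0 = 2 *: 1 - g - g * g.
Proof.
rewrite /fourier0; expand; rewrite xx yy_eq0 zz_eq0 quad_xy quad_xz; lmod_ring.
Qed.
Lemma fourier12 : fourier1 * fourier2 = w *: (1 - g) + w ^+ 2 *: (1 - g * g).
Proof.
rewrite /fourier1 /fourier2; expand; rewrite xx yy_eq0 zz_eq0 quad_xy quad_xz.
lmod_ring_mod w2.
Qed.
Lemma fourier21 : fourier2 * fourier1 = w ^+ 2 *: (1 - g) + w *: (1 - g * g).
Proof.
rewrite /fourier1 /fourier2; expand; rewrite xx yy_eq0 zz_eq0 quad_xy quad_xz.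
lmod_ring_mod w2.
Qed.
(** The squares vanish, and every mixed product has coefficient [1 + w + w ^+ 2 = 0]. *)
Lemma fourier01 : fourier0 * fourier1 + fourier1 * fourier0 + fourier2 * fourier2 = 0.
Proof.
rewrite /fourier0 /fourier1 /fourier2; expand; rewrite xx yy_eq0 zz_eq0.
lmod_ring_mod w2.
Qed.
Lemma fourier02 : fourier0 * fourier2 + fourier2 * fourier0 + fourier1 * fourier1 = 0.
Proof.
rewrite /fourier0 /fourier1 /fourier2; expand; rewrite xx yy_eq0 zz_eq0.
lmod_ring_mod w2.
Qed.
Lemma cycle_fourier0 : g * fourier0 = fourier0 * g.
Proof. by rewrite /fourier0; expand; rewrite cycle_x cycle_y cycle_z; lmod_ring. Qed.
Lemma cycle_fourier1 : g * fourier1 = w *: (fourier1 * g).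
Proof. by rewrite /fourier1; expand; rewrite cycle_x cycle_y cycle_z; lmod_ring_mod w2. Qed.
Lemma cycle_fourier2 : g * fourier2 = w ^+ 2 *: (fourier2 * g).
Proof. by rewrite /fourier2; expand; rewrite cycle_x cycle_y cycle_z; lmod_ring_mod w2. Qed.
Lemma h_fourier0 : h * fourier0 = - (fourier0 * h).
Proof. by rewrite /fourier0; expand; rewrite hx hy hz; lmod_ring. Qed.
Lemma h_fourier1 : h * fourier1 = - (fourier2 * h).
Proof. by rewrite /fourier1 /fourier2; expand; rewrite hx hy hz; lmod_ring. Qed.
Lemma h_fourier2 : h * fourier2 = - (fourier1 * h).
Proof. by rewrite /fourier1 /fourier2; expand; rewrite hx hy hz; lmod_ring. Qed.

End Relations.

(** * Restriction of scalars from an algebra to its base field *)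

Section Restriction.
Variables (k : fieldType) (B : algType k) (M : lmodType B).

(** A second name for the carrier of [M], so that it bears the action of [k] through [c%:A] beside
    the action of [B]. *)
Definition restr : Type := M.
HB.instance Definition _ := GRing.Zmodule.on restr.

Definition restr_scale (c : k) (u : restr) : restr := (c%:A : B) *: (u : M).

Lemma restr_scaleA a b u : restr_scale a (restr_scale b u) = restr_scale (a * b) u.
Proof. by rewrite /restr_scale scalerA -scalerAl mul1r scalerA. Qed.
Lemma restr_scale1 : left_id 1 restr_scale.
Proof. by move=> u; rewrite /restr_scale scale1r scale1r. Qed.
Lemma restr_scaleDr : right_distributive restr_scale +%R.
Proof. by move=> c u v; rewrite /restr_scale scalerDr. Qed.
Lemma restr_scaleDl u : {morph restr_scale^~ u : a b / a + b}.
Proof. by move=> a b; rewrite /restr_scale !scalerDl. Qed.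

HB.instance Definition _ := GRing.Zmodule_isLmodule.Build k restr
  restr_scaleA restr_scale1 restr_scaleDr restr_scaleDl.

Definition opr (b : B) (u : restr) : restr := b *: (u : M).

Lemma opr_linear b : linear (opr b).
Proof.
move=> c u v; rewrite /opr scalerDr; congr (_ + _).
change (b *: (c%:A *: (u : M)) = c%:A *: (b *: (u : M))).
by rewrite !scalerA -scalerAl -scalerAr mul1r mulr1.
Qed.

HB.instance Definition _ b := GRing.isLinear.Build k restr restr *:%R (opr b) (opr_linear b).

Lemma oprM a b u : opr a (opr b u) = opr (a * b) u.
Proof. by rewrite /opr scalerA. Qed.
Lemma opr1 u : opr 1 u = u.
Proof. by rewrite /opr scale1r. Qed.
Lemma oprD a b u : opr (a + b) u = opr a u + opr b u.
Proof. by rewrite /opr scalerDl. Qed.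
Lemma oprN a u : opr (- a) u = - opr a u.
Proof. by rewrite /opr scaleNr. Qed.
Lemma oprZ c a u : opr (c *: a) u = c *: opr a u.
Proof.
change ((c *: a) *: (u : M) = c%:A *: (a *: (u : M))).
by rewrite scalerA -scalerAl mul1r.
Qed.
Lemma opr0 u : opr 0 u = 0.
Proof. by rewrite /opr scale0r. Qed.
Definition oprE := (oprD, oprN, oprZ, opr1, opr0).
End Restriction.

(** * Bases adapted to the one-dimensional modules and to [W_st] *)

Section StandardBasis.
Variables (k : fieldType) (V : lmodType k).

Definition one_dim_basis (h h' x : V -> V) (n : V) (c : k) :=
  [/\ n != 0, h n = c *: n, h' n = c *: n & x n = 0].

Lemma one_dim_basis_action (h h' x : V -> V) n c :
  one_dim_basis h h' x n c ->
  [/\ forall j, h n = \sum_(i < 1) (c%:A : 'M_1) i j *: n,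
      forall j, h' n = \sum_(i < 1) (c%:A : 'M_1) i j *: n
    & forall j, x n = \sum_(i < 1) (0 : 'M_1) i j *: n].
Proof.
by move=> [_ hn h'n xn]; split=> j;
  rewrite big_ord1 !mxE ?hn ?h'n ?xn ?scale0r // !ord1 /= mulr1.
Qed.

Lemma one_dim_basis_free (n : V) (z : 'cV[k]_1) :
  n != 0 -> \sum_j z j 0 *: n = 0 -> z = 0.
Proof.
rewrite big_ord1 => n0 /eqP; rewrite scaler_eq0 (negbTE n0) orbF => /eqP z0.
by apply/matrixP => p q; rewrite !ord1 z0 mxE.
Qed.

(* [v] and [u] are acted upon by [h], [h'] as the canonical basis of [W_st] by
   [H_12], [H_23], and by [x] through the matrix [mat2 a b c d]. *)
Definition st_basis (h h' x : V -> V) (v u : V) (a b c d : k) :=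
  [/\ v != 0, h v = u /\ h u = v, h' v = v - u /\ h' u = - u
    & x v = a *: v + c *: u /\ x u = b *: v + d *: u].

Definition pair_fun (v u : V) (j : 'I_2) : V := if j == 0 then v else u.

Lemma mat2_action (f : V -> V) v u a b c d :
  f v = a *: v + c *: u -> f u = b *: v + d *: u ->
  forall j, f (pair_fun v u j) = \sum_i mat2 a b c d i j *: pair_fun v u i.
Proof.
move=> fv fu j; rewrite !big_ord_recl big_ord0 addr0 !mxE /=.
by case: j => [[|[|//]] ?].
Qed.

Lemma st_basis_action (h h' x : V -> V) v u a b c d :
  st_basis h h' x v u a b c d ->
  [/\ forall j, h (pair_fun v u j) = \sum_i mat2 0 1 1 0 i j *: pair_fun v u i,
      forall j, h' (pair_fun v u j) = \sum_i mat2 1 0 (-1) (-1) i j *: pair_fun v u i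
    & forall j, x (pair_fun v u j) = \sum_i mat2 a b c d i j *: pair_fun v u i].
Proof.
move=> [_ [hv hu] [h'v h'u] [xv xu]]; split; apply: mat2_action => //.
- by rewrite hv; lmod_ring.
- by rewrite hu; lmod_ring.
- by rewrite h'v; lmod_ring.
- by rewrite h'u; lmod_ring.
Qed.

(** Applying [h] and [h'] to a linear relation and combining the results eliminates [u]: both
    [z1 + 2 * z0] and [z0 + 2 * z1] kill [v]. This system has determinant [3] up to sign. *)
Lemma st_basis_free (h h' : {linear V -> V}) x v u a b c d (z : 'cV[k]_2) :
  3 != 0 :> k -> st_basis h h' x v u a b c d ->
  \sum_j z j 0 *: pair_fun v u j = 0 -> z = 0.
Proof.
move=> n3 [v0 [hv hu] [h'v h'u] _].
rewrite !big_ord_recl big_ord0 addr0 /pair_fun /=.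
set z0 := z ord0 0; set z1 := z (lift ord0 ord0) 0 => e0.
have e1 : z0 *: u + z1 *: v = 0.
  by have := congr1 h e0; rewrite linearD !linearZ_LR /= hv hu linear0.
have e2 : z0 *: (v - u) + z1 *: - u = 0.
  by have := congr1 h' e0; rewrite linearD !linearZ_LR /= h'v h'u linear0.
have e3 : z0 *: (u - v) + z1 *: - v = 0.
  have := congr1 h e2.
  by rewrite linearD !linearZ_LR /= linearB linearN /= hv hu linear0.
have v_eq0 (t : k) : t *: v = 0 -> t = 0.
  by move/eqP; rewrite scaler_eq0 (negbTE v0) orbF => /eqP.
have E1 : z1 + 2 * z0 = 0.
  apply: v_eq0; transitivity ((z0 *: v + z1 *: u) + (z0 *: u + z1 *: v)
    + (z0 *: (v - u) + z1 *: - u)); first lmod_ring.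
  by rewrite e0 e1 e2 !addr0.
have E2 : z0 + 2 * z1 = 0.
  apply: v_eq0; transitivity ((z0 *: u + z1 *: v) - (z0 *: (u - v) + z1 *: - v)).
    by lmod_ring.
  by rewrite e1 e3 subr0.
have z00 : z0 = 0.
  apply: (mulfI n3); rewrite mulr0.
  transitivity (2 * (z1 + 2 * z0) - (z0 + 2 * z1)); first by ring.
  by rewrite E1 E2 mulr0 subr0.
have z10 : z1 = 0 by rewrite -E1 z00 mulr0 addr0.
apply/matrixP => p q; rewrite mxE (ord1 q).
case: p => [[|[|//]] hp]; [rewrite -z00|rewrite -z10];
  by congr (z _ _); apply: val_inj.
Qed.
End StandardBasis.

(** * From special vectors to adapted bases *)

Section Vectors.
Variables (k : fieldType) (B : algType k) (x y z h h' : B) (M : lmodType B).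
Hypotheses (hh : h * h = 1) (h'h' : h' * h' = 1) (braid : h * h' * h = h' * h * h').
Hypotheses (hx : h * x = - (x * h)) (hy : h * y = - (z * h)) (hz : h * z = - (y * h)).
Hypotheses (h'x : h' * x = - (z * h')) (h'y : h' * y = - (y * h'))
  (h'z : h' * z = - (x * h')).
Hypotheses (xx : x * x = 0) (xyz : x * y + y * z + z * x = 1 - h * h').
Variables (w i : k).
Hypotheses (n3 : 3 != 0 :> k) (w2 : w ^+ 2 = - w - 1) (i2 : i ^+ 2 = -1).

(* A square root of [3], chosen so that the eigenvalues [+- s] give back [i]. *)
Let s := - (i * (2 * w + 1)).
Let s2 : s ^+ 2 = 3.
Proof. by rewrite /s sqrrN exprMn i2; ring: w2. Qed.

Local Notation "b • u" := (@opr k B M b u) (at level 40, left associativity).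

Lemma module_vectors (m : M) : m != 0 ->
  (exists n, exists2 c, c = 1 \/ c = -1 &
    one_dim_basis k _ (opr k B M h) (opr k B M h') (opr k B M x) n c) \/
  exists v u : restr k B M,
    (exists2 t, t = i \/ t = - i &
       st_basis k _ (opr k B M h) (opr k B M h') (opr k B M x) v u t t (- t) (- t)) \/
    (exists2 t, t = i / 3 \/ t = - (i / 3) &
       st_basis k _ (opr k B M h) (opr k B M h') (opr k B M x) v u t (- t) t (- t)).
Proof.
move=> m0.
pose f b : {linear restr k B M -> restr k B M} := opr k B M b.
(* Fourier inversion: the three transforms sum to [3 *: x]. *)
have f3 u : 3 *: (x • u) =
    fourier0 _ _ x y z • u + fourier1 _ _ x y z w • u + fourier2 _ _ x y z w • u.
  by rewrite -oprZ -!oprD; congr opr; rewrite /fourier0 /fourier1 /fourier2; lmod_ring_mod w2.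
have h'E u : h' • u = h • ((h * h') • u).
  by rewrite oprM mulrA hh mul1r.
pose E0 := f (fourier0 _ _ x y z).
pose E1 := f (fourier1 _ _ x y z w); pose E2 := f (fourier2 _ _ x y z w).
have : (exists n, one_dim_vector _ _ E0 E1 E2 (f (h * h')) (f h) n) \/
  exists l m p, [/\ l = s \/ l = - s, m = s \/ m = - s
                  & two_dim_vector _ _ w E0 E1 E2 (f (h * h')) (f h) l m p].
{ apply: (@special_vector_exists k _ w s n3 w2 s2 E0 E1 E2 (f (h * h')) (f h)).
  15: exact: m0.
  all: move=> u; rewrite /E0 /E1 /E2 /f /=.
  - by rewrite oprM (fourier00 _ _ _ _ _ h h') // !oprE oprM.
  - by rewrite oprM (fourier12 _ _ _ _ _ h h') // !oprE oprM.
  - by rewrite oprM (fourier21 _ _ _ _ _ h h') // !oprE oprM.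
  - by rewrite !oprM -!oprD (fourier01 _ _ _ _ _ h h') // oprE.
  - by rewrite !oprM -!oprD (fourier02 _ _ _ _ _ h h') // oprE.
  - by rewrite !oprM cycle_fourier0.
  - by rewrite !oprM (cycle_fourier1 _ _ _ _ _ h h') // oprE.
  - by rewrite !oprM (cycle_fourier2 _ _ _ _ _ h h') // oprE.
  - by rewrite !oprM h_fourier0 // oprE.
  - by rewrite !oprM (h_fourier1 _ _ _ _ _ h) // oprE.
  - by rewrite !oprM (h_fourier2 _ _ _ _ _ h) // oprE.
  - by rewrite !oprM hh oprE.
  - by rewrite !oprM -(mulrA (h * h')) cycle_cube // oprE.
  - by rewrite !oprM h_cycle // mulrA. }
case=> [[n [n0 gn hn [E0n E1n E2n]]]|]; first left.
  have xn : x • n = 0.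
    have := f3 n; rewrite E0n E1n E2n !addr0 => /eqP.
    by rewrite scaler_eq0 (negbTE n3) => /eqP.
  by case: hn => hn; exists n; [exists 1; first by left | exists (-1); first by right];
    split; rewrite ?scale1r ?scaleN1r // h'E gn.
case=> l [c [p [ls cs [p0 gp E0p E1p E2p]]]]; right.
pose q := h • p.
have hq : h • q = p by rewrite oprM hh opr1.
have w4 : (w ^+ 2) ^+ 2 = w by ring: w2.
have gq : (h * h') • q = w ^+ 2 *: q.
  have ghg : h * h' * h = h * (h * h' * (h * h')).
    by rewrite cycle_sqr // [h * (_ * _)]mulrA.
  rewrite /q oprM ghg -oprM -[_ • p]oprM (gp : (h * h') • p = _).
  by rewrite linearZ_LR /= (gp : (h * h') • p = _) scalerA -expr2 linearZ_LR.
have xp : x • p = 3^-1 *: (l *: p + c *: q).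
  by apply: (scalerI n3); rewrite f3 E0p E1p E2p addr0 scalerA mulfV // scale1r.
have xh u : x • (h • u) = - (h • (x • u)).
  by rewrite !oprM -oprN hx opprK.
have xq : x • q = - (3^-1 *: (l *: q + c *: p)).
  by rewrite /q xh xp linearZ_LR /= linearD /= !linearZ_LR /= -/q hq.
have h'p : h' • p = w *: q by rewrite h'E (gp : (h * h') • p = _) linearZ_LR.
have h'q : h' • q = w ^+ 2 *: p by rewrite h'E gq linearZ_LR /= hq.
have oD b u v : b • (u - w ^+ 2 *: v) = b • u - w ^+ 2 *: (b • v).
  by rewrite linearB linearZ_LR.
(* In the span of [p] and [q], [u] is the eigenvector of [h'] for [-1] required by [W_st], and [v]
   is its image under [h]. *)
set v := p - w ^+ 2 *: q; set u := q - w ^+ 2 *: p.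
have v0 : v != 0.
  apply: contraNneq p0 => /subr0_eq pE.
  have qE : q = w ^+ 2 *: p by rewrite -hq -linearZ_LR -pE.
  (* If [v = 0] then [p = w *: p], which is impossible because [(w + 2) * (1 - w) = 3]. *)
  have : 3 *: p = (w + 2) *: (p - w *: p) by lmod_ring_mod w2.
  rewrite {2}pE qE scalerA -expr2 w4 subrr scaler0 => /eqP.
  by rewrite scaler_eq0 (negbTE n3).
have hv : h • v = u /\ h • u = v by rewrite !oD hq.
have h'v : h' • v = v - u /\ h' • u = - u.
  by rewrite !oD h'p h'q; split; lmod_ring_mod w2.
have xv : x • v = 3^-1 *: (l *: p + c *: q) + w ^+ 2 *: (3^-1 *: (l *: q + c *: p)).
  by rewrite oD xp xq scalerN opprK.
have xu : x • u = - (3^-1 *: (l *: q + c *: p)) - w ^+ 2 *: (3^-1 *: (l *: p + c *: q)).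
  by rewrite oD xp xq.
(* This puts both sides over the denominator [3], leaving a polynomial identity. *)
have i3 : i = 3^-1 * (3 * i) by rewrite mulrA mulVf ?mul1r.
(* Equal eigenvalues [l = c] make [x v] a multiple of [v + u], with parameter [i / 3] up to sign;
   opposite ones make it a multiple of [v - u], with parameter [i] up to sign. *)
exists v, u; move: xv xu; case: ls => ->; case: cs => ->; rewrite /s => xv xu.
+ right; exists (- (i / 3)); first by right.
  by split=> //; rewrite xv xu; split; lmod_ring_mod w2.
+ left; exists i; first by left.
  by split=> //; rewrite xv xu; split; rewrite [in RHS]i3; lmod_ring_mod w2.
+ left; exists (- i); first by right.
  by split=> //; rewrite xv xu; split; rewrite [in RHS]i3; lmod_ring_mod w2.
+ right; exists (i / 3); first by left.
  by split=> //; rewrite xv xu; split; lmod_ring_mod w2.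
Qed.
End Vectors.

(** * Modules over A1 *)

Section Generators.
Variable k : fieldType.

Lemma HgM t s : Hg k t * Hg k s = Hg k (s * t)%g.
Proof. exact/A1_rel/A1rel_mul. Qed.

Lemma Hg_tperm_sqr (p q : 'I_3) : Hg k (tperm p q) * Hg k (tperm p q) = 1.
Proof. by rewrite HgM tperm2; exact/A1_rel/A1rel_one. Qed.

Lemma Hg_tperm_ag (t i j : transposition) : val j = (val i ^ val t)%g ->
  Hg k (val t) * ag k i = - (ag k j * Hg k (val t)).
Proof.
move=> /(A1rel_conj (Hg k) (ag k)) /A1_rel ->.
by case: (transpositionP t) => ->; rewrite odd_tperm /= expr1 scaleN1r.
Qed.

Lemma tpermJ_t12 : [/\ val t12 = (val t12 ^ val t12)%g, val t13 = (val t23 ^ val t12)%g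
  & val t23 = (val t13 ^ val t12)%g].
Proof. by split; rewrite /= tpermJ !permE // tpermC. Qed.

Lemma tpermJ_t23 : [/\ val t13 = (val t12 ^ val t23)%g, val t23 = (val t23 ^ val t23)%g
  & val t12 = (val t13 ^ val t23)%g].
Proof. by split; rewrite /= tpermJ !permE // tpermC. Qed.

Lemma Hg_braid : Hg k (val t12) * Hg k (val t23) * Hg k (val t12) =
  Hg k (val t23) * Hg k (val t12) * Hg k (val t23).
Proof.
rewrite !HgM; congr Hg; transitivity (val t13 : {perm 'I_3}).
  by case: tpermJ_t12 => _ -> _; rewrite /conjg tpermV mulgA.
by case: tpermJ_t23 => -> _ _; rewrite /conjg tpermV mulgA.
Qed.

End Generators.

(** * Induction principles for the free algebra and for [A1] *)

Lemma freealg_ind (k : fieldType) (G : choiceType) (P : freealg k G -> Prop) :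
  (forall c x y, P x -> P y -> P (c *: x + y)) ->
  (forall x y, P x -> P y -> P (x * y)) ->
  P 1 -> (forall g, P (fgen k g)) -> forall x, P x.
Proof.
move=> PL PM P1 Pg x.
have P0 : P 0 by have := PL (-1) _ _ P1 P1; rewrite scaleN1r addNr.
(* [x] is a linear combination of words, and each word is built one letter at a time. *)
rewrite (monalgE x); elim/big_rec: _ => // m y _ Py.
rewrite -[X in P (X + _)]scale1r; apply: (PL) => //.
move: (x@_m) => c; case: m => s; rewrite -fmE; elim: s => [|g s IH].
  have -> : << c *g fmonom_of_seq fmonom_key [::] >> = c *: 1 + 0 :> freealg k G.
    by rewrite addr0 -mul_malgC mulr1 /fmone.
  exact: PL.
have -> : << c *g fmonom_of_seq fmonom_key (g :: s) >> =
    fgen k g * << c *g fmonom_of_seq fmonom_key s >> :> freealg k G.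
  rewrite malgM_def fgmulUU mul1r; congr (<< _ *g _ >>); apply: val_inj.
  by rewrite /= fmM fmU !fmE.
exact: PM.
Qed.

(** [H_12], [H_23] and [a_12] generate [A1]: the transposition [(13)] is a product of the other two,
    transpositions generate the symmetric group, and the other [a_i] are conjugates of [a_12] up to
    sign. *)
Lemma A1_ind (k : fieldType) (P : A1 k -> Prop) :
  (forall c x y, P x -> P y -> P (c *: x + y)) ->
  (forall x y, P x -> P y -> P (x * y)) -> P 1 ->
  P (Hg k (val t12)) -> P (Hg k (val t23)) -> P (ag k t12) -> forall x, P x.
Proof.
move=> PL PM P1 P12 P23 Pa.
have H1 : Hg k 1%g = 1 by exact/A1_rel/A1rel_one.
have P13 : P (Hg k (val t13)).
  have -> : val t13 = (val t12 * val t23 * val t12)%g :> {perm 'I_3}.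
    by rewrite -{1}[val t12]tpermV -mulgA -/(conjg _ _) tpermJ !permE.
  by rewrite -!HgM; apply: (PM) => //; apply: (PM).
have Pt (t : transposition) : P (Hg k (val t)).
  by case: (transpositionP t) => ->.
have PH t : P (Hg k t).
  have [ts -> /allP] := prod_tpermP t.
  elim: ts => [|[x y] ts IH] dts; first by rewrite big_nil H1.
  rewrite big_cons -HgM; apply: (PM); last first.
    have xy : x != y by apply: (dts (x, y)); rewrite inE eqxx.
    exact: (Pt (exist _ (tperm x y) (is_transposition_tperm xy))).
  by apply: IH => p pts; apply: dts; rewrite inE pts orbT.
have PZ c x : P x -> P (c *: x).
  move=> Px; have P0 : P 0 by have := PL (-1) _ _ P1 P1; rewrite scaleN1r addNr.
  by rewrite -[_ *: _]addr0; apply: (PL).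
(* Since [H_t] is an involution, the commutation relation reads [a_j = - H_t a_i H_t]. *)
have Pconj (t i j : transposition) :
    val j = (val i ^ val t)%g -> P (ag k i) -> P (ag k j).
  move=> /(Hg_tperm_ag k) e Pi.
  have tt : Hg k (val t) * Hg k (val t) = 1.
    by case: (transpositionP t) => ->; apply: Hg_tperm_sqr.
  have -> : ag k j = (-1) *: (Hg k (val t) * ag k i * Hg k (val t)).
    by rewrite e mulNr scalerN scaleN1r opprK -mulrA tt mulr1.
  by apply: (PZ); apply: (PM) => //; apply: (PM).
have [e13 _ _] := tpermJ_t23.
have e23 : val t23 = (val t12 ^ val t13)%g by rewrite /= tpermJ !permE tpermC.
have Pi i : P (ag k i).
  by case: (transpositionP i) => ->;
    [|apply: (Pconj _ _ _ e13 Pa)|apply: (Pconj _ _ _ e23 Pa)].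
move=> x; rewrite -[x]qreprK; move: (qrepr x).
apply: (@freealg_ind k A1gen (fun y => P (qpi _ y))) => [c x' y|x' y||[t|i]].
- by rewrite raddfD /= qpiZ; apply: (PL).
- by rewrite rmorphM; apply: (PM).
- by rewrite rmorph1.
- exact: PH.
- exact: Pi.
Qed.

(** * Isomorphisms onto a simple module *)

Lemma isomorphic_of_bijective (R : pzRingType) (M N : lmodType R) (f : {linear M -> N}) :
  injective f -> (forall y, exists x, f x = y) -> isomorphic N M.
Proof.
move=> f_inj /choice[g gK].
have fK : cancel f g by move=> u; apply: f_inj; rewrite gK.
pose gL := GRing.isLinear.Build R N M *:%R g (can2_linear fK gK).
pose g' : {linear N -> M} := HB.pack g gL.
by exists g'; exists f.
Qed.

(** The image of [f] is a nonzero submodule of a simple module. *)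
Lemma simple_image_full (R : pzRingType) (M N : lmodType R) (f : {linear M -> N}) u :
  simple_module N -> f u != 0 -> forall y, exists x, f x = y.
Proof.
move=> [_ /(_ (fun y => `[< exists x, f x = y >]))] + fu0 y.
case.
- split=> [|a y1 y2 /asboolP[x1 <-] /asboolP[x2 <-]]; apply/asboolP.
    by exists 0; rewrite linear0.
  by exists (a *: x1 + x2); rewrite linearP.
- move=> /(_ (f u)); rewrite inE (negbTE fu0) => /asboolP; case; by exists u.
- by move=> /(_ y); rewrite inE => /asboolP.
Qed.

Section RepHom.
Variables (k : fieldType) (r : A1rep k) (M : lmodType (A1 k)).
Local Notation n := (A1rep_dim r).
Local Notation opr := (@opr k (A1 k) M).
Variable e : 'I_n.+1 -> restr k (A1 k) M.

Definition rep_hom (c : repmod r) : M := \sum_j (c : 'cV_n.+1) j 0 *: e j.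

Definition acts_as_rep (b : A1 k) :=
  forall j, opr b (e j) = \sum_i rep_eval r b i j *: e i.

Hypotheses (act12 : acts_as_rep (Hg k (val t12))) (act23 : acts_as_rep (Hg k (val t23)))
  (acta : acts_as_rep (ag k t12)).

Lemma rep_hom_linear (a : k) (c d : 'cV[k]_n.+1) :
  rep_hom (a *: c + d) = a *: (rep_hom c : restr k (A1 k) M) + rep_hom d.
Proof.
rewrite /rep_hom scaler_sumr -big_split /=; apply: eq_bigr => j _.
by rewrite !mxE scalerDl scalerA.
Qed.

Lemma rep_hom_acts b c : acts_as_rep b -> rep_hom (b *: c) = b *: rep_hom c.
Proof.
move=> act; change (rep_hom (rep_eval r b *m c) = opr b (rep_hom c)).
rewrite /rep_hom (linear_sum (opr b)) /=.
transitivity (\sum_j \sum_i (rep_eval r b i j * c j 0) *: e i).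
  rewrite exchange_big /=; apply: eq_bigr => i _.
  by rewrite mxE scaler_suml.
apply: eq_bigr => j _; rewrite (linearZ_LR (opr b)) /= act scaler_sumr.
by apply: eq_bigr => i _; rewrite scalerA mulrC.
Qed.

(** The elements of [A1] that commute with [rep_hom] form a subalgebra, so the three generators
    suffice. *)
Lemma rep_hom_scalable b c : rep_hom (b *: c) = b *: rep_hom c.
Proof.
move: b c; apply: A1_ind => [a b b' IH IH' c|b b' IH IH' c|c|c|c|c].
- have -> : (a *: b + b') *: c = a *: (b *: c : 'cV_n.+1) + b' *: c.
    change (rep_eval r (a *: b + b') *m c = a *: (rep_eval r b *m c) + rep_eval r b' *m c).
    by rewrite linearP mulmxDl -scalemxAl.
  rewrite rep_hom_linear IH IH'.
  change (a *: opr b (rep_hom c) + opr b' (rep_hom c) = opr (a *: b + b') (rep_hom c)).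
  by rewrite !oprE.
- by rewrite -!scalerA IH IH'.
- by rewrite !scale1r.
- exact: rep_hom_acts.
- exact: rep_hom_acts.
- exact: rep_hom_acts.
Qed.

(** Linear independence of the [e j] makes [rep_hom] injective, and simplicity of [M] makes it
    surjective. *)
Lemma isomorphic_repmod :
  (forall c : 'cV[k]_n.+1, \sum_j c j 0 *: e j = 0 -> c = 0) ->
  simple_module M -> isomorphic M (repmod r).
Proof.
move=> e_free simpleM.
have hom_linear : linear rep_hom.
  move=> a c d; rewrite -rep_hom_scalable.
  by have := rep_hom_linear 1 (a *: c) d; rewrite !scale1r.
pose fL := GRing.isLinear.Build _ (repmod r) M *:%R rep_hom hom_linear.
pose f : {linear repmod r -> M} := HB.pack rep_hom fL.
have f0 c : f c = 0 -> c = 0 by apply: e_free.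
apply: (@isomorphic_of_bijective _ _ _ f) => [c d fcd|].
  by apply/eqP; rewrite -subr_eq0; apply/eqP/f0; rewrite linearB fcd subrr.
apply: (@simple_image_full _ _ _ f (const_mx 1 : 'cV_n.+1)) simpleM _.
apply/eqP => /f0 /matrixP /(_ 0 0); rewrite !mxE => /eqP.
by rewrite oner_eq0.
Qed.
End RepHom.

HB.instance Definition _ (k : fieldType) (r : A1rep k) :=
  GRing.Linear.on (@rep_eval k r).

(** * Annihilators of the simple modules *)

Section Annihilators.
Variables (k : fieldType).

Definition same_ann (r r' : A1rep k) :=
  forall b, rep_eval r b = 0 -> rep_eval r' b = 0.

(** An element acting by zero in [r] kills [M], hence every basis column of [repmod r']. *)
Lemma isomorphic_same_ann (M : lmodType (A1 k)) (r r' : A1rep k) :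
  isomorphic M (repmod r) -> isomorphic M (repmod r') -> same_ann r r'.
Proof.
move=> [f [f' fK f'K]] [f1 [f1' f1K f1'K]] b rb.
have bM (m : M) : b *: m = 0.
  have fbm : f (b *: m) = 0.
    rewrite linearZ; change (rep_eval r b *m (f m : 'cV_ _) = 0).
    by rewrite rb mul0mx.
  by rewrite -[LHS]fK fbm -(linear0 f) fK.
apply/matrixP => i j; rewrite mxE.
have : b *: (delta_mx j 0 : repmod r') = 0.
  by rewrite -[delta_mx j 0]f1'K -linearZ /= bM linear0.
move=> bj.
have /matrixP/(_ i 0) : rep_eval r' b *m delta_mx j 0 = 0 :> 'cV[k]_((A1rep_dim r').+1).
  exact: bj.
by rewrite -colE !mxE.
Qed.

(* For [(c, d) = (3, 1)], resp. [(1, -1)], the second term with [e = theta] acts on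
   [W_st] as [c a_12] does in [S_st(theta)] for [theta ^ 2 = -1], resp.
   [theta ^ 2 = -1/9]. *)
Definition st_test (B : algType k) (x h h' h'' : B) (c d e : k) : B :=
  c *: x - e *: ((h' - h'') * (1 + d *: h)).

Lemma st_test_morph (B C : algType k) (phi : {lrmorphism B -> C}) x h h' h'' c d e :
  phi (st_test B x h h' h'' c d e) = st_test C (phi x) (phi h) (phi h') (phi h'') c d e.
Proof.
rewrite /st_test rmorphB /= [phi (c *: _)]linearZ [phi (e *: _)]linearZ /=.
by rewrite rmorphM rmorphB rmorphD /= [phi (d *: _)]linearZ rmorph1.
Qed.

Lemma lrmorphD_scalar (B C : algType k) (phi : {lrmorphism B -> C}) b c :
  phi (b + c%:A) = phi b + c%:A.
Proof. by rewrite rmorphD /= [phi (c *: _)]linearZ rmorph1. Qed.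

Lemma rep_evalD (r : A1rep k) (b : A1 k) c : rep_eval r (b + c%:A) = rep_eval r b + c%:A.
Proof. exact: (lrmorphD_scalar (A1 k) 'M[k]_((A1rep_dim r).+1) (rep_eval r)). Qed.

(** The test element is [H_12 - 1], and [H_12 + 1] for the sign module below. *)
Lemma same_ann_eps r : same_ann (rep_eps k) r -> repH r (val t12) = 1.
Proof.
move/(_ (Hg k (val t12) + (-1)%:A)); rewrite !rep_evalD !rep_evalH !scaleN1r subrr.
by move=> /(_ erefl) /subr0_eq.
Qed.

Lemma same_ann_sgn r : same_ann (rep_sgn k) r -> repH r (val t12) = -1.
Proof.
move/(_ (Hg k (val t12) + 1%:A)); rewrite !rep_evalD !rep_evalH !scale1r /=.
rewrite /sgnmx odd_tperm /= addNr.
by move/(_ erefl)/eqP; rewrite addr_eq0 => /eqP.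
Qed.

Definition A1_st_test :=
  st_test (A1 k) (ag k t12) (Hg k (val t12)) (Hg k (val t23)) (Hg k (val t13)).

Lemma rep_eval_st_test (r : A1rep k) c d e :
  rep_eval r (A1_st_test c d e) = c *: repa r t12
    - e *: ((repH r (val t23) - repH r (val t13)) * (1 + d *: repH r (val t12))).
Proof.
rewrite -rep_evala -!rep_evalH.
exact: (st_test_morph (A1 k) 'M[k]_((A1rep_dim r).+1) (rep_eval r)).
Qed.

Hypotheses (n2 : 2 != 0 :> k) (n3 : 3 != 0 :> k).

Lemma mat2Z (a b c d e : k) : e *: mat2 a b c d = mat2 (e * a) (e * b) (e * c) (e * d).
Proof. by apply: mat2P; rewrite !mxE. Qed.
Lemma mat2_inj (a b c d a' b' c' d' : k) : mat2 a b c d = mat2 a' b' c' d' :> 'M[k]_2 ->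
  [/\ a = a', b = b', c = c' & d = d'].
Proof.
move=> e; have E i j := congr1 (fun A : 'M_2 => A i j) e.
by move: (E 0 0) (E 0 1) (E 1 0) (E 1 1); rewrite !mxE.
Qed.

Lemma st_mx1_Hst :
  (Hst k (val t23) - Hst k (val t13)) * (1 + 1 *: Hst k (val t12)) = st_mx1 (3 : k).
Proof.
rewrite Hst12 Hst13 Hst23 mat21 mat2Z mat2N !mat2D mat2M; congr mat2; ring.
Qed.
Lemma st_mx2_Hst :
  (Hst k (val t23) - Hst k (val t13)) * (1 + - 1 *: Hst k (val t12)) = st_mx2 (1 : k).
Proof.
rewrite Hst12 Hst13 Hst23 mat21 mat2Z mat2N !mat2D mat2M; congr mat2; ring.
Qed.

Lemma ast_t12 (A : 'M[k]_2) : ast A t12 = A. Proof. by rewrite /ast eqxx. Qed.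

(** The test element built from [t] acts on the module with parameter [u] by [st_mx1 (3 * (u - t))],
    so it vanishes only for [u = t]. *)
Lemma same_ann_st1 t (ht : t ^+ 2 = -1) t' (ht' : t' ^+ 2 = -1) :
  same_ann (rep_st1 ht) (rep_st1 ht') -> t = t'.
Proof.
have E u (hu : u ^+ 2 = -1) :
    rep_eval (rep_st1 hu) (A1_st_test 3 1 t) = st_mx1 (3 * (u - t)).
  rewrite rep_eval_st_test /= ast_t12 st_mx1_Hst !mat2Z mat2N mat2D; congr mat2; ring.
move/(_ (A1_st_test 3 1 t)); rewrite !E subrr mulr0 mat20 /st_mx1 oppr0.
move=> /(_ erefl) /mat2_inj[/eqP + _ _ _].
by rewrite mulf_eq0 (negbTE n3) subr_eq0 => /eqP.
Qed.

Lemma same_ann_st2 t (ht : 9 * t ^+ 2 = -1) t' (ht' : 9 * t' ^+ 2 = -1) :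
  same_ann (rep_st2 ht) (rep_st2 ht') -> t = t'.
Proof.
have E u (hu : 9 * u ^+ 2 = -1) :
    rep_eval (rep_st2 hu) (A1_st_test 1 (-1) t) = st_mx2 (u - t).
  rewrite rep_eval_st_test /= ast_t12 st_mx2_Hst !mat2Z mat2N mat2D; congr mat2; ring.
move/(_ (A1_st_test 1 (-1) t)); rewrite !E subrr mat20 /st_mx2 oppr0.
by move=> /(_ erefl) /mat2_inj[/eqP + _ _ _]; rewrite subr_eq0 => /eqP.
Qed.

(** The test element killing the first module acts on the second by
    [3 *: st_mx2 t' - t *: st_mx1 3]. Its vanishing forces [t = 0], against [t ^+ 2 = -1]. *)
Lemma same_ann_mixed t (ht : t ^+ 2 = -1) t' (ht' : 9 * t' ^+ 2 = -1) :
  ~ same_ann (rep_st1 ht) (rep_st2 ht').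
Proof.
move/(_ (A1_st_test 3 1 t)); rewrite !rep_eval_st_test /= !ast_t12 !st_mx1_Hst.
rewrite !mat2Z !mat2N !mat2D => E.
have /E : mat2 (3 * t + - (t * 3)) (3 * t + - (t * 3)) (3 * - t + - (t * -3))
     (3 * - t + - (t * -3)) = 0 :> 'M[k]_2 by rewrite mat20; congr mat2; ring.
rewrite mat20 => /mat2_inj[e1 e2 _ _].
(* The sum of the two entries in the first row is [- 6 * t]. *)
have /eqP : 2 * (3 * t) = 0.
  apply: oppr_inj; rewrite oppr0 -[RHS]addr0 -{1}e1 -e2; ring.
rewrite !mulf_eq0 (negbTE n2) (negbTE n3) => /eqP t0.
by move/eqP: ht; rewrite t0 expr0n eq_sym oppr_eq0 oner_eq0.
Qed.

Lemma mx1_neqN1 n : 1 <> -1 :> 'M[k]_n.+1.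
Proof.
move/matrixP/(_ 0 0); rewrite !mxE /= => /eqP; rewrite -addr_eq0.
by rewrite -[1 + 1]/2%:R (negbTE n2).
Qed.

Lemma Hst12_neq c : Hst k (val t12) <> c%:A.
Proof.
rewrite Hst12 mat21 mat2Z mulr0 mulr1 => /mat2_inj[_ /eqP + _ _].
by rewrite oner_eq0.
Qed.
End Annihilators.

(** * Classification of the simple modules *)

Lemma A1_module_vectors (k : fieldType) (M : lmodType (A1 k)) (w i : k) :
  3 != 0 :> k -> w ^+ 2 = - w - 1 -> i ^+ 2 = -1 -> forall m : M, m != 0 ->
  let h := opr k (A1 k) M (Hg k (val t12)) in
  let h' := opr k (A1 k) M (Hg k (val t23)) in
  let x := opr k (A1 k) M (ag k t12) in
  (exists n, exists2 c, c = 1 \/ c = -1 & one_dim_basis k _ h h' x n c) \/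
  exists v u,
    (exists2 t, t = i \/ t = - i & st_basis k _ h h' x v u t t (- t) (- t)) \/
    (exists2 t, t = i / 3 \/ t = - (i / 3) & st_basis k _ h h' x v u t (- t) t (- t)).
Proof.
move=> n3 w2 i2 m m0 h h' x.
apply: (@module_vectors k (A1 k) (ag k t12) (ag k t23) (ag k t13)
  (Hg k (val t12)) (Hg k (val t23)) M
  (Hg_tperm_sqr k _ _) (Hg_tperm_sqr k _ _) (Hg_braid k)
  _ _ _ _ _ _ _ _ w i n3 w2 i2 m m0).
- by apply: Hg_tperm_ag; case: tpermJ_t12.
- by apply: Hg_tperm_ag; case: tpermJ_t12.
- by apply: Hg_tperm_ag; case: tpermJ_t12.
- by apply: Hg_tperm_ag; case: tpermJ_t23.
- by apply: Hg_tperm_ag; case: tpermJ_t23.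
- by apply: Hg_tperm_ag; case: tpermJ_t23.
- exact: (A1_rel (A1rel_sq (Hg k) (ag k))).
- exact: (A1_rel (A1rel_quad (Hg k) (ag k))).
Qed.

Section SimpleModules.
Variables (k : fieldType) (M : lmodType (A1 k)).
Local Notation opr := (opr k (A1 k) M).

Lemma isomorphic_one_dim (n : restr k (A1 k) M) (c : k) H a
    (rel : forall l r, @A1rel k 'M[k]_1 H a l r -> l = r) :
  simple_module M ->
  one_dim_basis k _ (opr (Hg k (val t12))) (opr (Hg k (val t23))) (opr (ag k t12)) n c ->
  H (val t12) = c%:A -> H (val t23) = c%:A -> a t12 = 0 ->
  isomorphic M (repmod {| A1rep_dim := 0; repH := H; repa := a; rep_rel := rel |}).
Proof.
move=> simpleM nS H12 H23 a12; case: (nS) => n0 _ _ _.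
have [h_act h'_act x_act] := one_dim_basis_action k _ _ _ _ _ _ nS.
pose r := {| A1rep_dim := 0; repH := H; repa := a; rep_rel := rel |}.
apply: (isomorphic_repmod k r M (fun=> n) _ _ _ _ simpleM).
- by move=> j; rewrite rep_evalH (H12 : repH r (val t12) = _); apply: h_act.
- by move=> j; rewrite rep_evalH (H23 : repH r (val t23) = _); apply: h'_act.
- by move=> j; rewrite rep_evala (a12 : repa r t12 = _); apply: x_act.
- by move=> z; apply: one_dim_basis_free.
Qed.

Lemma isomorphic_two_dim (n3 : 3 != 0 :> k) (v u : restr k (A1 k) M) (a b c d : k)
    (rel : forall l r, A1rel (Hst k) (ast (mat2 a b c d)) l r -> l = r) :
  simple_module M ->
  st_basis k _ (opr (Hg k (val t12))) (opr (Hg k (val t23))) (opr (ag k t12)) v u a b c d ->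
  isomorphic M (repmod
    {| A1rep_dim := 1; repH := Hst k; repa := ast (mat2 a b c d); rep_rel := rel |}).
Proof.
move=> simpleM vuS.
have [h_act h'_act x_act] := st_basis_action k _ _ _ _ _ _ _ _ _ _ vuS.
pose r := {| A1rep_dim := 1; repH := Hst k; repa := ast (mat2 a b c d); rep_rel := rel |}.
apply: (isomorphic_repmod k r M (pair_fun k _ v u) _ _ _ _ simpleM).
- by move=> j; rewrite rep_evalH (Hst12 k : repH r (val t12) = _); apply: h_act.
- by move=> j; rewrite rep_evalH (Hst23 k : repH r (val t23) = _); apply: h'_act.
- by move=> j; rewrite rep_evala (ast_t12 k _ : repa r t12 = _); apply: x_act.
- by move=> z; apply: (st_basis_free k _ _ _ _ _ _ _ _ _ _ z n3 vuS).
Qed.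
End SimpleModules.

Theorem theorem5p8 (k : closedFieldType) (char0 : [pchar k] =i pred0)
    (i : k) (i2 : i ^+ 2 = -1) (M : lmodType (A1 k)) :
  simple_module M ->
  exists! l : simple_label, isomorphic M (simple_A1 char0 i2 l).
Proof.
move=> simpleM.
have n2 : 2 != 0 :> k by rewrite (pcharf0P k).1.
have n3 : 3 != 0 :> k by rewrite (pcharf0P k).1.
have [w w2] : exists w : k, w ^+ 2 = - w - 1.
  (* With both lower coefficients [-1], the equation is [w ^+ 2 = -1 - w], whose roots are the
     primitive cube roots of unity. *)
  have [w wE] := @solve_monicpoly k 2 (fun _ => -1) isT.
  by exists w; rewrite wE !big_ord_recl big_ord0; ring.
have i_neq0 : i != 0.
  by apply/eqP => i0; move/eqP: i2; rewrite i0 expr0n eq_sym oppr_eq0 oner_eq0.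
have neqN (a : k) : a != 0 -> a <> - a.
  move=> a0 /eqP; rewrite -addr_eq0 -mulr2n -mulr_natl mulf_eq0.
  by rewrite (negbTE n2) (negbTE a0).
have i3_neq0 : i / 3 != 0 by rewrite mulf_neq0 // invr_eq0.
(* [H_12] would act as [1], but it acts as [-1] on [S_sgn] and by a nonscalar matrix on [W_st]. *)
have epsU l : same_ann k (rep_eps k) (label_rep char0 i2 l) -> L_eps = l.
{ move/same_ann_eps; case: l => //= e; exfalso.
    by apply: (mx1_neqN1 _ n2 0); move: e; rewrite /sgnmx odd_tperm.
  all: by case: (Hst12_neq k 1); rewrite scale1r. }
have sgnU l : same_ann k (rep_sgn k) (label_rep char0 i2 l) -> L_sgn = l.
{ move/same_ann_sgn; case: l => //= e; exfalso.
    by apply: (mx1_neqN1 _ n2 0).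
  all: by apply: (Hst12_neq k (-1)); rewrite scaleN1r. }
have uniq l l' : isomorphic M (simple_A1 char0 i2 l) ->
    isomorphic M (simple_A1 char0 i2 l') -> l = l'.
{ move=> Ml Ml'.
  (* The tests compare two modules in one direction only, so both inclusions of annihilators are
     recorded. *)
  have S := isomorphic_same_ann _ _ _ _ Ml Ml'.
  have S' := isomorphic_same_ann _ _ _ _ Ml' Ml.
  have st1 := @same_ann_st1 k n3; have st2 := @same_ann_st2 k.
  have st12 := @same_ann_mixed k n2 n3.
  case: l {Ml} S S' => S S'; [exact: epsU S | exact: sgnU S | ..].
  all: case: l' {Ml'} S S' => S S'; [by have := epsU _ S' | by have := sgnU _ S' | ..].
  - by [].
  - by case: (neqN i) => //; apply: st1 S.
  - by case: (st12 _ _ _ _ S).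
  - by case: (st12 _ _ _ _ S).
  - by case: (neqN i) => //; apply: st1 S'.
  - by [].
  - by case: (st12 _ _ _ _ S).
  - by case: (st12 _ _ _ _ S).
  - by case: (st12 _ _ _ _ S').
  - by case: (st12 _ _ _ _ S').
  - by [].
  - by case: (neqN (i / 3)) => //; apply: st2 S.
  - by case: (st12 _ _ _ _ S').
  - by case: (st12 _ _ _ _ S').
  - by case: (neqN (i / 3)) => //; apply: st2 S'.
  - by []. }
suff [l Ml] : exists l, isomorphic M (simple_A1 char0 i2 l).
  by exists l; split=> // l'; apply: uniq.
have [[m m0] _] := simpleM.
have [[n [c c1 nS]]|[v [u [[t te vuS]|[t te vuS]]]]] :=
    A1_module_vectors k M w i n3 w2 i2 m m0.
- case: c1 nS => -> nS; [exists L_eps | exists L_sgn].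
    by apply: (isomorphic_one_dim _ _ _ _ _ _ _ simpleM nS); rewrite ?scale1r.
  by apply: (isomorphic_one_dim _ _ _ _ _ _ _ simpleM nS);
    rewrite ?scaleN1r /sgnmx ?odd_tperm.
- by case: te vuS => -> vuS; [exists L_st_i | exists L_st_Ni];
    apply: (isomorphic_two_dim _ _ n3 _ _ _ _ _ _ _ simpleM vuS).
- by case: te vuS => -> vuS; [exists L_st_i3 | exists L_st_Ni3];
    apply: (isomorphic_two_dim _ _ n3 _ _ _ _ _ _ _ simpleM vuS).
Qed.
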